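(* Consider the model below with exactly one changepoint ($J=1$) at location $\eta$, with sparsity $k=\|\theta_1\|_0$, $\phi=\|\theta_1\|_2$ and $\Delta=\min(\eta,n-\eta)$. Let the scores be computed from the rescaled matrix $\widetilde X = X/\sigma$ with penalty function $\lambda(t)=\lambda_0 r(t)$, and let $$\widehat\eta_\lambda = \text{the smallest maximiser over } 0<v<n \text{ of } S^v_{\lambda,(0,n]} .$$ Then there exist a universal choice of $\lambda_0>0$ and universal constants $C_0,C_1>0$ such that, whenever $$\frac{\phi^2\Delta}{\sigma^2}\ \ge\ C_0\, h(k),$$ we have $$\mathbb{P}\Big\{|\widehat\eta_\lambda-\eta|\le C_1\frac{\sigma^2}{\phi^2}h(k)\Big\}\ \ge\ 1-\frac1n .$$
   Context: Model: integers $n\ge2$, $p\ge1$, $\sigma>0$. We observe $X=\mu+W\in\mathbb{R}^{p\times n}$ where the entries $W_{i,v}$ are i.i.d. $N(0,\sigma^2)$ and $\mu\in\mathbb{R}^{p\times n}$ is deterministic with columns $\mu_v\in\mathbb{R}^p$. There are $J\ge0$ changepoints $0<\eta_1<\dots<\eta_J<n$ such that $\mu_v\ne\mu_{v+1}$ iff $v=\eta_j$ for some $j$. Let $\theta_j=\mu_{\eta_j+1}-\mu_{\eta_j}$, $\phi_j=\|\theta_j\|_2$, $k_j=\|\theta_j\|_0$ (number of nonzero entries), and $\Delta_j=\min(\eta_j-\eta_{j-1},\eta_{j+1}-\eta_j)$ with $\eta_0=0,\eta_{J+1}=n$. All logarithms are natural. CUSUM: for $y\in\mathbb{R}^n$ and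 integers $0\le s<v<e\le n$, $T^v_{(s,e]}(y)=\sqrt{\tfrac{e-v}{(e-s)(v-s)}}\sum_{t=s+1}^v y_t-\sqrt{\tfrac{v-s}{(e-s)(e-v)}}\sum_{t=v+1}^e y_t$. For an input matrix $Y$ with rows $Y_{i,\cdot}$, write $C^v_{(s,e]}(i)=T^v_{(s,e]}(Y_{i,\cdot})$. Threshold and centering: $a^2(t)=4\log\!\big(\tfrac{ep\log n}{t^2}\big)\,\mathbb{1}\{t\le (p\log n)^{1/2}\}$ (with $a(t)\ge0$), and for $a\ge0$, $\nu_a=\mathbb{E}(Z^2\mid |Z|\ge a)$ with $Z\sim N(0,1)$. For $t\in[p]$: $r(t)=(p\log n)^{1/2}$ if $t\ge(p\log n)^{1/2}$, and $r(t)=\max\{t\log(\tfrac{ep\log n}{t^2}),\log n\}$ otherwise; $h(t)=[p\max\{\log n,\log\log(ep)\}]^{1/2}$ if $t\ge(p\log n)^{1/2}$, and $h(t)=\max\{t\log(\tfrac{ep\log n}{t^2}),\log n\}$ otherwise. Candidate sparsities: $\mathcal{T}=\{2^m: m\ge0,\ 2^m\le \lfloor (p\log n)^{1/2}\rfloor\}\cup\{p\}$. Penalized score: for a penalty function $g:[p]\to\mathbb{R}$, $S^v_{g,(s,e]}(t)=\sum_{i=1}^p\{C^v_{(s,e]}(i)^2-\nu_{a(t)}\}\mathbb{1}\{|C^v_{(s,e]}(i)|\ge a(t)\}-g(t)$ and $S^v_{g,(s,e]}=\max_{t\in\mathcal{T}}S^v_{g,(s,e]}(t)$. *)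

(* Defs.v *)
From HB Require Import structures.
From mathcomp Require Import all_boot all_order all_algebra.
From mathcomp Require Import all_classical all_reals all_analysis.
Set Implicit Arguments. Unset Strict Implicit. Unset Printing Implicit Defensive.
Import Order.TTheory GRing.Theory Num.Theory.
Local Open Scope classical_set_scope.
Local Open Scope ring_scope.

Section Defs.
Variable R : realType.

(* CUSUM T^v_{(s,e]}(y) for y indexed by times 1..n (y : nat -> R, y t = y_t). *)
Definition cusum (y : nat -> R) (s v e : nat) : R :=
  Num.sqrt ((e - v)%:R / ((e - s)%:R * (v - s)%:R)) * (\sum_(s.+1 <= t < v.+1) y t)
  - Num.sqrt ((v - s)%:R / ((e - s)%:R * (e - v)%:R)) * (\sum_(v.+1 <= t < e.+1) y t).

Definition plogn (p n : nat) : R := p%:R * ln n%:R.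

Definition a_sq (p n t : nat) : R :=
  if t%:R <= Num.sqrt (plogn p n)
  then 4 * ln (expR 1 * plogn p n / (t%:R ^+ 2)) else 0.
Definition a_thr (p n t : nat) : R := Num.sqrt (a_sq p n t).

Definition nu (a : R) : R :=
  fine ((\int[normal_prob 0 1]_(x in [set x : R | (a <= `|x|)%R]) (x ^+ 2)%:E)%E)
  / fine (normal_prob 0 1 [set x : R | a <= `|x|]).

Definition r_fun (p n t : nat) : R :=
  if Num.sqrt (plogn p n) <= t%:R then Num.sqrt (plogn p n)
  else Num.max (t%:R * ln (expR 1 * plogn p n / (t%:R ^+ 2))) (ln n%:R).
Definition h_fun (p n t : nat) : R :=
  if Num.sqrt (plogn p n) <= t%:R
  then Num.sqrt (p%:R * Num.max (ln n%:R) (ln (ln (expR 1 * p%:R))))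
  else Num.max (t%:R * ln (expR 1 * plogn p n / (t%:R ^+ 2))) (ln n%:R).

(* Candidate sparsities T = {2^m : 2^m <= floor((p log n)^{1/2})} u {p}.
   Any such m satisfies m < 2^m <= floor(..), so m ranges over iota 0 (|floor|+1). *)
Definition floor_sqrt (p n : nat) : int := Num.floor (Num.sqrt (plogn p n)).
Definition cand_set (p n : nat) : seq nat :=
  p :: map (fun m : nat => (2 ^ m)%N)
         (seq.filter (fun m : nat => (((2 ^ m)%N)%:Z <= floor_sqrt p n)%R)
                 (iota 0 `|floor_sqrt p n|%N.+1)).

Definition score_t (p n : nat) (Y : 'I_p -> nat -> R) (g : nat -> R)
    (s v e t : nat) : R :=
  \sum_(i < p)
     (if a_thr p n t <= `|cusum (Y i) s v e|
      then cusum (Y i) s v e ^+ 2 - nu (a_thr p n t) else 0)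
  - g t.

(* S^v_{g,(s,e]} = max_{t in T} S^v_{g,(s,e]}(t)  (T is nonempty as p \in T) *)
Definition score (p n : nat) (Y : 'I_p -> nat -> R) (g : nat -> R)
    (s v e : nat) : R :=
  \big[Num.max/score_t n Y g s v e p]_(t <- cand_set p n) score_t n Y g s v e t.

Definition smallest_argmax (n : nat) (f : nat -> R) : nat :=
  let M := \big[Num.max/f 1%N]_(1 <= v < n) f v in
  nth 0%N (iota 1 n.-1) (find (fun v => f v == M) (iota 1 n.-1)).

Definition eta_hat (p n : nat) (Y : 'I_p -> nat -> R) (g : nat -> R) : nat :=
  smallest_argmax n (fun v => score n Y g 0 v n).

Definition mutually_independent d (T : measurableType d) (P : probability T R)
    (I : finType) (X : I -> T -> R) : Prop :=
  forall (J : {set I}) (B : I -> set R), (forall i, measurable (B i)) ->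
    P (\bigcap_(i in [set i | i \in J]) (X i @^-1` B i)) =
    (\prod_(i in J) P (X i @^-1` B i))%E.

End Defs.

(* Main.v *)
(* After dividing by sigma, row i of the CUSUM matrix at time v is
   C_i(v) = - theta_i psi_v + Z_i(v), where the Z_i(v) are i.i.d. standard Gaussian over i and
   psi_v is the CUSUM of a unit step at eta.  Put D_v = psi_eta^2 - psi_v^2; it is the harmonic
   combination xy/(x+y) of y = |v - eta| and of the distance x from eta to one end of the sample.
   With A_v = |theta|^2 psi_v^2 - 2 psi_v <theta, Z(v)> the three ingredients are, off an event of
   probability at most 1/n:
   - for every v and every candidate t, the score is at most A_v + O(h);
   - at v = eta some candidate t has score at least A_eta - O(h);
   - the cross term 2 <theta, psi_eta Z(eta) - psi_v Z(v)> is Gaussian with variance exactly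
     4 |theta|^2 D_v, hence at most |theta|^2 D_v / 2 + O(log n).
   A maximiser v therefore satisfies |theta|^2 D_v = O(h), which bounds |v - eta|.
   Off the support of theta the thresholded sums are controlled by the penalty; on a dense support,
   thresholding can only lose compared with the plain chi-square statistic, up to fluctuations,
   because a shifted Gaussian is stochastically larger in absolute value than a centered one. *)
Require Import Defs.
From HB Require Import structures.
From mathcomp Require Import all_boot all_order all_algebra.
From mathcomp Require Import all_classical all_reals all_analysis.
From mathcomp Require Import measurable_realfun interval_inference ring lra zify.
Set Implicit Arguments. Unset Strict Implicit. Unset Printing Implicit Defensive.
Import Order.TTheory GRing.Theory Num.Theory.
Local Open Scope classical_set_scope.
Local Open Scope ring_scope.

(** * Integrals against a density and affine changes of variables *)

(** What shapes the proof is the union bound over the roughly [log p] candidate sparsities, which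
    may not cost a [log log p] in the sparse range. Put [q = sqrt (p log n)] and [rho = n^-(K-2)]. A
    variance proxy of order [p (t/q)^2] for the noise thresholded at [a(t)] would yield only the
    flat probability [rho]. The threshold gives [p (t/q)^3], and the extra factor [t/q] improves the
    failure probability to [rho * (1/t + t/q)], whose sum over powers of two is [O(rho)]. On a dense
    support the loss caused by thresholding has no such gain: all candidates share one tail bound,
    and the [log log (ep)] inside [h] pays for their number. The second obstacle is integrability.
    All expectations are integrals of nonnegative functions, and signed terms are split into
    positive and negative parts moved across inequalities. Moment bounds thus reduce to pointwise
    inequalities against [exp (3/8 x^2)] and [exp (15/32 x^2)], whose Gaussian integrals are exactly
    2 and 4. *)

Section density.
Context d (T : measurableType d) (R : realType).
Variables (mu nu : {measure set T -> \bar R}) (g : T -> R).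
Hypotheses (g0 : forall x, 0 <= g x) (mg : measurable_fun setT g).
Hypothesis nuE : forall A, measurable A -> nu A = (\int[mu]_(x in A) (g x)%:E)%E.

Let integral_density_indic E : measurable E ->
  (\int[nu]_x (\1_E x)%:E = \int[mu]_x ((\1_E x)%:E * (g x)%:E))%E.
Proof.
move=> mE; rewrite integral_indic// setIT nuE// integral_mkcond.
apply: eq_integral => x _; rewrite patchE indicE.
by case: ifP; rewrite ?mul1e ?mul0e.
Qed.

Import HBNNSimple.

Let integral_density_nnsfun (f : {nnsfun T >-> R}) :
  (\int[nu]_x (f x)%:E = \int[mu]_x ((f x)%:E * (g x)%:E))%E.
Proof.
under [LHS]eq_integral do rewrite fimfunE -fsumEFin//.
rewrite [LHS]ge0_integral_fsum//; last 2 first.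
  - by move=> r; exact/measurable_EFinP/measurableT_comp.
  - by move=> n x _; rewrite EFinM nnfun_muleindic_ge0.
under [RHS]eq_integral.
  move=> x xD; rewrite fimfunE -fsumEFin// ge0_mule_fsuml; last first.
    by move=> r; rewrite EFinM nnfun_muleindic_ge0.
  over.
rewrite [RHS]ge0_integral_fsum//; last 2 first.
  - move=> r; apply/emeasurable_funM; last exact/measurable_EFinP.
    by apply/measurable_EFinP; do 2 apply/measurableT_comp => //.
  - by move=> n x _; rewrite mule_ge0 ?lee_fin// -lee_fin EFinM nnfun_muleindic_ge0.
apply: eq_fsbigr => r _.
under [RHS]eq_integral do rewrite EFinM -muleA.
rewrite integralZl_indic_nnsfun//= integral_density_indic//.
have [r0|r0] := leP 0 r.
  rewrite ge0_integralZl ?lee_fin//; last first.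
    by move=> x _; rewrite mule_ge0 ?lee_fin.
  apply/emeasurable_funM; last exact/measurable_EFinP.
  by apply/measurable_EFinP; apply/measurable_indic.
have -> : f @^-1` [set r] = set0.
  by apply/seteqP; split => // x /= fxr; have : 0 <= f x by []; rewrite fxr leNgt r0.
by under eq_integral do rewrite indic0 mul0e; under [RHS]eq_integral do rewrite indic0 mul0e mule0;
  rewrite integral0 mule0.
Qed.

(** Indicators, then simple functions, then monotone convergence; nonnegative extended-real
    integrands keep it free of integrability conditions. *)
Lemma ge0_integral_density (f : T -> \bar R) :
  measurable_fun setT f -> (forall x, 0 <= f x)%E ->
  (\int[nu]_x f x = \int[mu]_x (f x * (g x)%:E))%E.
Proof.
move=> mf f0.
pose f_ := nnsfun_approx measurableT mf.
transitivity (lim (\int[nu]_x (f_ n x)%:E @[n --> \oo])%E).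
  rewrite -monotone_convergence//=.
  - apply: eq_integral => ? /[!inE] xD; apply/esym/cvg_lim => //=.
    exact: cvg_nnsfun_approx.
  - by move=> n; exact/measurable_EFinP/measurable_funTS.
  - by move=> n ? _; rewrite lee_fin.
  - by move=> ? _ ? ? mn; rewrite lee_fin; exact/lefP/nd_nnsfun_approx.
transitivity (lim (\int[mu]_x ((f_ n x)%:E * (g x)%:E) @[n --> \oo])%E); last first.
  rewrite -monotone_convergence//=.
  - apply: eq_integral => x /[!inE] xD.
    apply/cvg_lim => //; apply: cvgeZr => //; exact: cvg_nnsfun_approx.
  - move=> n; apply: emeasurable_funM; last exact/measurable_EFinP.
    exact/measurable_EFinP/measurable_funTS.
  - by move=> n ? _; rewrite mule_ge0 ?lee_fin.
  - move=> ? _ ? ? ?; rewrite lee_pmul ?lee_fin//; exact/lefP/nd_nnsfun_approx.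
by apply: congr_lim; apply/funext => n /=; exact: integral_density_nnsfun.
Qed.
End density.

Section affine.
Context {R : realType}.
Local Notation leb := (@lebesgue_measure R).
Implicit Types (f : R -> \bar R) (c e : R).

Lemma measurable_affine c e : measurable_fun [set: R] (fun x : R => c * x + e).
Proof. by apply: measurable_funD => //; apply: measurable_funM. Qed.

(** The pushforward under the affine map, scaled by [|c|], gives every half-open interval its
    length, so it is Lebesgue measure by uniqueness. *)
Lemma ge0_integral_affine c e f : c != 0 ->
  measurable_fun setT f -> (forall x, 0 <= f x)%E ->
  (\int[leb]_x f x = `|c|%:E * \int[leb]_x f (c * x + e)%R)%E.
Proof.
move=> c0 mf f0.
have cgt0 : 0 < `|c| by rewrite normr_gt0.
pose phi := (fun x : R => c * x + e) : measurableTypeR R -> measurableTypeR R.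
have mphi : measurable_fun setT phi by exact: measurable_affine.
pose m0 := mscale (NngNum (normr_ge0 c)) (pushforward leb phi).
pose m := m0 mphi.
have mE A : measurable A -> leb A = m A.
  apply: lebesgue_measure_unique => _ [[a b] _ <-] /=.
  rewrite /m /m0 /mscale /= /pushforward.
  (* A negative slope turns the interval into one closed on the left; its length is unaffected. *)
  have -> : phi @^-1` `]a, b]%classic =
     if 0 < c then `](a - e) / c, (b - e) / c]%classic
     else `[(b - e) / c, (a - e) / c[%classic.
    case: ifPn => cs; apply/seteqP; split => x; rewrite /phi /= !in_itv /=.
    - by rewrite ltr_pdivrMr// ler_pdivlMr// (mulrC x); move=> /andP[? ?]; apply/andP; split; lra.
    - by rewrite ltr_pdivrMr// ler_pdivlMr// (mulrC x); move=> /andP[? ?]; apply/andP; split; lra.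
    - have cn : c < 0 by rewrite lt_neqAle c0 leNgt.
      by rewrite ltr_ndivlMr// ler_ndivrMr// (mulrC x); move=> /andP[? ?]; apply/andP; split; lra.
    - have cn : c < 0 by rewrite lt_neqAle c0 leNgt.
      by rewrite ltr_ndivlMr// ler_ndivrMr// (mulrC x); move=> /andP[? ?]; apply/andP; split; lra.
  case: ifPn => cs; rewrite !lebesgue_measure_itv /= !lte_fin.
    rewrite ltr_pM2r ?invr_gt0// ltrD2r; case: ifP => _; last by rewrite mule0.
    by rewrite -!EFinB -EFinM gtr0_norm//; congr _%:E; field.
  have cn : c < 0 by rewrite lt_neqAle c0 leNgt.
  rewrite ltr_nM2r ?invr_lt0// ltrD2r; case: ifP => _; last by rewrite mule0.
  by rewrite -!EFinB -EFinM ltr0_norm//; congr _%:E; field.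
rewrite (@eq_measure_integral _ _ _ _ m); last by move=> A mA _; exact: mE.
rewrite /m /m0 ge0_integral_mscale//= ge0_integral_pushforward//.
Qed.
End affine.

(** * Gaussian integrals *)

Section gauss.
Context {R : realType}.
Local Notation leb := (@lebesgue_measure R).
Local Notation gam := (@normal_prob R 0 1).
Local Notation phi := (@normal_pdf R 0 1).
Implicit Types (f : R -> \bar R) (m s x a b : R).

Lemma normal_pdfE1 m s x : s != 0 ->
  normal_pdf m s x = normal_peak 1 / `|s| * expR (- ((x - m) / s) ^+ 2 / 2).
Proof.
move=> s0; rewrite normal_pdfE// /normal_peak /normal_fun expr1n mul1r; congr (_ * expR _).
  rewrite -mulrnAr sqrtrM ?sqr_ge0// sqrtr_sqr invfM mulrC; congr (_ * _).
by rewrite -mulr_natr; field.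
Qed.

Lemma std_pdfE x : phi x = normal_peak 1 * expR (- x ^+ 2 / 2).
Proof. by rewrite normal_pdfE1 ?oner_neq0// normr1 !divr1 subr0. Qed.

Let mEpdf m s : measurable_fun setT (fun x : R => (normal_pdf m s x)%:E).
Proof. by apply/measurable_EFinP; exact: measurable_normal_pdf. Qed.

Lemma ge0_integral_normal m s f :
  measurable_fun setT f -> (forall x, 0 <= f x)%E ->
  (\int[normal_prob m s]_x f x = \int[leb]_x (f x * (normal_pdf m s x)%:E))%E.
Proof.
move=> mf f0; apply: ge0_integral_density => //.
- by move=> x; exact: normal_pdf_ge0.
- exact: measurable_normal_pdf.
Qed.

Lemma ge0_integral_normal_scale s f : 0 < s ->
  measurable_fun setT f -> (forall x, 0 <= f x)%E ->
  (\int[normal_prob 0 s]_x f x = \int[gam]_x f (s * x)%R)%E.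
Proof.
move=> s0 mf f0.
have ms : measurable_fun setT (fun x : R => s * x) by exact: measurable_funM.
have mfs : measurable_fun setT (fun x => f (s * x)) by exact: measurableT_comp.
rewrite !ge0_integral_normal//.
rewrite (@ge0_integral_affine _ s 0) ?gt_eqF//; last 2 first.
- by apply: emeasurable_funM => //; exact: mEpdf.
- by move=> x; rewrite mule_ge0// lee_fin normal_pdf_ge0.
rewrite -ge0_integralZl//; first last.
- by move=> x _; rewrite mule_ge0// lee_fin normal_pdf_ge0.
- apply: (@measurableT_comp _ _ _ _ _ _ (fun x => f x * (normal_pdf 0 s x)%:E)%E).
    by apply: emeasurable_funM => //; exact: mEpdf.
  exact: measurable_affine.
apply: eq_integral => x _; rewrite addr0 muleCA -EFinM; congr (_ * _%:E)%E.
rewrite normal_pdfE1 ?gt_eqF// std_pdfE gtr0_norm// subr0 mulrA mulrCA divff ?gt_eqF// mulr1.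
by congr (_ * expR (- _ ^+ 2 / 2)); rewrite mulrAC divff ?gt_eqF// mul1r.
Qed.

(** The weight is the density quotient [phi (x - m) / phi x]. *)
Lemma ge0_integral_gauss_shift m f :
  measurable_fun setT f -> (forall x, 0 <= f x)%E ->
  (\int[gam]_x f (m + x)%R = \int[gam]_x (f x * (expR (m * x - m ^+ 2 / 2))%:E))%E.
Proof.
move=> mf f0.
have ms : measurable_fun setT (fun x : R => m + x) by exact: measurable_funD.
have me : measurable_fun setT (fun x : R => (expR (m * x - m ^+ 2 / 2))%:E).
  apply/measurable_EFinP/measurableT_comp => //.
  by apply: measurable_funD => //; exact: measurable_funM.
have mfs : measurable_fun setT (fun x => f (m + x)) by exact: measurableT_comp.
rewrite !ge0_integral_normal//; first last.
- by move=> x; rewrite mule_ge0// lee_fin expR_ge0.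
- exact: emeasurable_funM.
rewrite (@ge0_integral_affine _ 1 (- m)) ?oner_eq0//; last 2 first.
- by apply: emeasurable_funM => //; exact: mEpdf.
- by move=> x; rewrite mule_ge0// lee_fin normal_pdf_ge0.
rewrite normr1 mul1e; apply: eq_integral => x _.
rewrite mul1r addrCA subrr addr0 -muleA -EFinM; congr (_ * _%:E)%E.
rewrite !std_pdfE mulrCA -expRD; congr (_ * expR _); by field.
Qed.

(** Against [phi], the integrand is [s] times the density of standard deviation [s]. Parametrising
    by [s] makes the values explicit: [s = 2] and [s = 4] give the exponents [3/8] and [15/32]. *)
Lemma integral_gauss_sqr s : 0 < s ->
  (\int[gam]_x (expR ((1 - s ^- 2) / 2 * x ^+ 2))%:E = s%:E)%E.
Proof.
move=> s0.
have me : measurable_fun setT (fun x : R => (expR ((1 - s ^- 2) / 2 * x ^+ 2))%:E).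
  apply/measurable_EFinP/measurableT_comp => //.
  by apply: measurable_funM => //; exact: measurable_funX.
rewrite ge0_integral_normal//.
under eq_integral => x _.
  have -> : ((expR ((1 - s ^- 2) / 2 * x ^+ 2))%:E * (phi x)%:E =
     s%:E * (normal_pdf 0 s x)%:E)%E.
    rewrite -!EFinM std_pdfE normal_pdfE1 ?gt_eqF// gtr0_norm// subr0; congr _%:E.
    rewrite mulrCA -expRD [RHS]mulrA (mulrC s) divfK ?gt_eqF//.
    by congr (_ * expR _); field; rewrite gt_eqF.
  over.
rewrite ge0_integralZl//=.
- by rewrite integral_normal_pdf mule1.
- exact: mEpdf.
- by move=> x _; rewrite lee_fin normal_pdf_ge0.
- by rewrite lee_fin ltW.
Qed.

(* Completing the square: as a density in [z] and then in [x],
   [phi x * N(a x, b^2)(z) = phi z * N(a z, b^2)(x)]. *)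
Let rot_aux a b f : b != 0 -> a ^+ 2 + b ^+ 2 = 1 ->
  measurable_fun setT f -> (forall x, 0 <= f x)%E ->
  (\int[gam]_x \int[gam]_y f (a * x + b * y)%R = \int[gam]_z f z)%E.
Proof.
move=> b0 ab mf f0.
pose k (w : R * R) := (phi w.1 * (`|b|^-1 * phi ((w.2 - a * w.1) / b)))%R.
have k0 w : 0 <= k w by rewrite !mulr_ge0// ?normal_pdf_ge0.
have mk : measurable_fun setT k.
  apply: measurable_funM; first by apply: measurableT_comp => //; exact: measurable_normal_pdf.
  apply: measurable_funM => //; apply: measurableT_comp; first exact: measurable_normal_pdf.
  apply: measurable_funM => //; apply: measurable_funB => //; exact: measurable_funM.
have inner x : (\int[gam]_y f (a * x + b * y)%R * (phi x)%:E =
   \int[leb]_z (f z * (k (x, z))%:E))%E.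
  have mfs : measurable_fun setT (fun y => f (a * x + b * y)).
    by apply: measurableT_comp => //; apply: measurable_funD => //; exact: measurable_funM.
  rewrite ge0_integral_normal//.
  rewrite (@ge0_integral_affine _ b^-1 (- (a * x / b))) ?invr_eq0//; last 2 first.
  - exact: emeasurable_funM.
  - by move=> y; rewrite mule_ge0// lee_fin normal_pdf_ge0.
  have mphi' : measurable_fun setT (fun y : R => (phi (b^-1 * y - a * x / b))%:E).
    apply: (@measurableT_comp _ _ _ _ _ _ (fun y : R => (phi y)%:E)) => //.
    exact: measurable_affine.
  have mf' : measurable_fun setT (fun y : R => f (a * x + b * (b^-1 * y - a * x / b))).
    apply: (@measurableT_comp _ _ _ _ _ _ (fun y => f (a * x + b * y))) => //.
    exact: measurable_affine.
  rewrite -ge0_integralZl//; first last.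
  - by move=> y _; rewrite mule_ge0// lee_fin normal_pdf_ge0.
  - exact: emeasurable_funM.
  rewrite muleC -ge0_integralZl//; first last.
  - by rewrite lee_fin normal_pdf_ge0.
  - by move=> y _; rewrite !mule_ge0 ?lee_fin// normal_pdf_ge0.
  - by apply: emeasurable_funM => //; exact: emeasurable_funM.
  apply: eq_integral => z _.
  have -> : a * x + b * (b^-1 * z - a * x / b) = z by field.
  have -> : b^-1 * z - a * x / b = (z - a * x) / b by field.
  by rewrite 2!(muleCA _ (f z)) -!EFinM /k /= normfV.
pose F (w : R * R) := (f w.2 * (k w)%:E)%E.
have mF : measurable_fun setT F.
  by apply: emeasurable_funM; [exact: measurableT_comp|exact/measurable_EFinP].
have F0 w : (0 <= F w)%E by rewrite mule_ge0 ?lee_fin.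
have mfab : measurable_fun setT (fun w : R * R => f (a * w.1 + b * w.2)).
  by apply: measurableT_comp => //; apply: measurable_funD; exact: measurable_funM.
rewrite ge0_integral_normal//; first last.
- by move=> x; apply: integral_ge0.
- have f0' (w : R * R) : (0 <= f (a * w.1 + b * w.2)%R)%E by [].
  exact: (@measurable_fun_fubini_tonelli_F _ _ _ _ _ gam _ mfab f0').
under eq_integral do rewrite inner.
have := @fubini_tonelli _ _ _ _ _ leb leb F mF F0 => ->.
rewrite ge0_integral_normal//.
apply: eq_integral => z _.
under eq_integral => x _.
  rewrite [F _](_ : _ = (f z * (phi z)%:E) * (normal_pdf (a * z) b x)%:E)%E; last first.
    rewrite /F /k /= -muleA -EFinM; congr (_ * _%:E)%E.
    rewrite (normal_pdfE1 (a * z) x b0) !std_pdfE.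
    set K := normal_peak 1; set e1 := expR _; set e2 := expR _; set e3 := expR _; set e4 := expR _.
    (* Multiplied by [b ^+ 2 = 1 - a ^+ 2], both quadratic forms become [x^2 + z^2 - 2 a x z] over
       2, which is symmetric in [x] and [z]. *)
    have e12 : e1 * e2 = e3 * e4.
      rewrite -!expRD; congr expR.
      have ba : b ^+ 2 = 1 - a ^+ 2 by rewrite -ab; ring.
      have b20 : b ^+ 2 != 0 by rewrite expf_neq0.
      rewrite !mulNr -!opprD; congr (- _).
      apply: (mulIf b20).
      transitivity ((x ^+ 2 * b ^+ 2 + (z - a * x) ^+ 2) / 2); first by field.
      transitivity ((z ^+ 2 * b ^+ 2 + (x - a * z) ^+ 2) / 2); last by field.
      by rewrite ba; congr (_ / 2); ring.
    transitivity (K * K / `|b| * (e1 * e2)); first by ring.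
    by rewrite e12; ring.
  over.
rewrite ge0_integralZl//=.
- by rewrite integral_normal_pdf mule1.
- exact: mEpdf.
- by move=> x _; rewrite lee_fin normal_pdf_ge0.
- by rewrite mule_ge0// lee_fin normal_pdf_ge0.
Qed.

(** Rotation invariance, reduced to [a^2 + b^2 = 1] by dividing by the norm; the form is chosen so
    that adding an independent term to a Gaussian sum is a single rewrite. *)
Lemma ge0_integral_gauss_rot a b f :
  measurable_fun setT f -> (forall x, 0 <= f x)%E ->
  (\int[gam]_x \int[gam]_y f (a * x + b * y)%R =
   \int[gam]_z f (Num.sqrt (a ^+ 2 + b ^+ 2) * z)%R)%E.
Proof.
move=> mf f0; set t := Num.sqrt _.
have ab0 : 0 <= a ^+ 2 + b ^+ 2 by rewrite addr_ge0 ?sqr_ge0.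
have [t0|t0] := eqVneq t 0.
  have /eqP := t0; rewrite sqrtr_eq0 => ab.
  have : a ^+ 2 + b ^+ 2 == 0 by rewrite eq_le ab.
  rewrite paddr_eq0 ?sqr_ge0// !sqrf_eq0 => /andP[/eqP -> /eqP ->].
  under eq_integral => x _.
    under eq_integral do rewrite !mul0r addr0.
    rewrite integral_cst//= probability_setT mule1.
    over.
  by rewrite t0; under [RHS]eq_integral do rewrite mul0r.
have tE : t ^+ 2 = a ^+ 2 + b ^+ 2 by rewrite sqr_sqrtr.
have mg : measurable_fun setT (fun z => f (t * z)).
  by apply: measurableT_comp => //; exact: measurable_funM.
have fE x y : f (a * x + b * y) = f (t * (a / t * x + b / t * y)).
  by congr f; field.
have ab1 : (a / t) ^+ 2 + (b / t) ^+ 2 = 1.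
  by rewrite !expr_div_n -mulrDl -tE divff// expf_neq0.
under eq_integral do under eq_integral do rewrite fE.
(* The normalised identity divides by its second coefficient; when that one vanishes, Tonelli
   exchanges the two variables. *)
have [b0|b0] := eqVneq b 0; last first.
  by rewrite (@rot_aux (a / t) (b / t) (fun z => f (t * z)))// mulf_neq0 ?invr_eq0.
have a0 : a / t != 0.
  apply: contra_eq_neq ab1 => ->; rewrite b0 mul0r expr0n/= addr0.
  by rewrite eq_sym oner_neq0.
pose F (w : R * R) := f (t * (a / t * w.1 + b / t * w.2)).
have mF : measurable_fun setT F.
  apply: (@measurableT_comp _ _ _ _ _ _ (fun z => f (t * z))) => //.
  by apply: measurable_funD; exact: measurable_funM.
have F0 w : (0 <= F w)%E by exact: f0.
rewrite (@fubini_tonelli _ _ _ _ _ gam gam F mF F0).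
rewrite -(@rot_aux (b / t) (a / t) (fun z => f (t * z)))//; last by rewrite addrC.
apply: eq_integral => x _; apply: eq_integral => y _.
by rewrite /F/= addrC.
Qed.

Lemma integral_gauss_expR m :
  (\int[gam]_x (expR (m * x))%:E = (expR (m ^+ 2 / 2))%:E)%E.
Proof.
have me c : measurable_fun setT (fun x : R => (expR (m * x + c))%:E).
  by apply/measurable_EFinP/measurableT_comp => //; exact: measurable_affine.
have := @ge0_integral_gauss_shift m (cst 1%E) (@measurable_cst _ _ _ _ _ _) (fun=> lee01).
rewrite /= integral_cst//= mul1e probability_setT.
under [X in _ = X -> _]eq_integral do rewrite mul1e.
move=> e; rewrite -[RHS]mule1 e -ge0_integralZl ?lee_fin ?expR_ge0//.
by apply: eq_integral => x _; rewrite -EFinM -expRD; congr (expR _)%:E; ring.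
exact: me.
Qed.

(** The law is given by test functions on a scaled standard normal, so that [s = 0] is a point mass,
    as the empty sum requires. *)
Definition gauss_law d (Om : measurableType d) (P : probability Om R)
    (U : Om -> R) (s : R) :=
  forall f : R -> \bar R, measurable_fun setT f -> (forall x, 0 <= f x)%E ->
    (\int[P]_w f (U w) = \int[gam]_z f (s * z)%R)%E.
End gauss.

(** * Independence of blocks of coordinates *)

Section blocks.
Context d (Om : measurableType d) (R : realType) (P : probability Om R).
Context (I : finType) (X : I -> Om -> R).
Hypothesis mX : forall i, measurable_fun setT (X i).
Hypothesis indX : mutually_independent P X.
Implicit Types (A B : {set I}) (E F : set Om).

(** A pi-system generating the sigma-algebra of the coordinates in [A], made of exactly the events
    on which [mutually_independent] factorises. *)
Definition cylinder A : set (set Om) :=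
  [set E | exists2 B : I -> set R, forall i, measurable (B i) &
     E = \bigcap_(i in [set i | i \in A]) (X i @^-1` B i)].

Local Notation block A := (g_sigma_algebraType (cylinder A)).

Lemma cylinder_measurable A : cylinder A `<=` measurable.
Proof.
move=> _ [B mB ->]; apply: fin_bigcap_measurable; first exact: finite_finset; move=> i _.
by rewrite -[X in measurable X]setTI; exact: mX.
Qed.

Lemma cylinderT A : cylinder A setT.
Proof.
exists (fun=> setT) => //; apply/seteqP; split => // w _ i _.
Qed.

Lemma cylinderI A : setI_closed (cylinder A).
Proof.
move=> _ _ [B mB ->] [C mC ->]; exists (fun i => B i `&` C i).
  by move=> i; exact: measurableI.
by apply/seteqP; split => w /=; [move=> [h1 h2] i Ai; split; [exact: h1|exact: h2]|
  move=> h; split => i Ai; have [] := h i Ai].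
Qed.

Lemma block_measurable A E : <<s cylinder A>> E -> measurable E.
Proof.
apply: smallest_sub; first exact: sigma_algebra_measurable.
exact: cylinder_measurable.
Qed.

Lemma measurable_block_coord A i : i \in A ->
  measurable_fun [set: block A] (X i : block A -> R).
Proof.
move=> Ai _ Y mY; rewrite setTI; apply: sub_sigma_algebra.
exists (fun j => if j == i then Y else setT); first by move=> j; case: ifP.
apply/seteqP; split => w /=; first by move=> h j Aj; case: eqP => [->|].
by move=> /(_ i Ai); rewrite eqxx.
Qed.

Lemma block_fun_measurable A d' (T : measurableType d') (U : Om -> T) :
  measurable_fun [set: block A] (U : block A -> T) -> measurable_fun [set: Om] U.
Proof.
move=> mU _ Y mY; apply: (@block_measurable A).
by rewrite setTI; have := mU measurableT Y mY; rewrite setTI.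
Qed.

(** Uniqueness of measures on a pi-system, used twice: with a cylinder [H] fixed, [G |-> P (G & H)]
    and [P H * P G] agree on cylinders, hence on the generated sigma-algebra; then the other side is
    extended in the same way. *)
Lemma block_independent A B E F : disjoint (mem A) (mem B) ->
  <<s cylinder A>> E -> <<s cylinder B>> F -> P (E `&` F) = (P E * P F)%E.
Proof.
move=> dAB.
have H0 G H : cylinder A G -> cylinder B H -> P (G `&` H) = (P G * P H)%E.
  move=> [C mC ->] [D mD ->].
  (* Disjointness of the blocks lets the two families of sets be glued into one cylinder over the
     union. *)
  pose K i := if i \in A then C i else D i.
  have mK i : measurable (K i) by rewrite /K; case: ifP.
  have KA i : i \in A -> K i = C i by rewrite /K => ->.
  have KB i : i \in B -> K i = D i.
    by move=> iB; rewrite /K; rewrite (disjointFl dAB iB).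
  have -> : \bigcap_(i in [set i | i \in A]) (X i @^-1` C i) `&`
     \bigcap_(i in [set i | i \in B]) (X i @^-1` D i) =
     \bigcap_(i in [set i | i \in A :|: B]) (X i @^-1` K i).
    apply/seteqP; split => w /=.
      move=> [h1 h2] i /=; rewrite inE => /orP[iA|iB].
        by rewrite KA//; exact: h1.
      by rewrite KB//; exact: h2.
    move=> h; split => i /= ii.
      by have := h i; rewrite /= inE ii KA//; exact.
    by have := h i; rewrite /= inE ii orbT KB//; exact.
  rewrite !indX// (eq_bigl [predU A & B]) ?bigU//=; last by move=> i; rewrite !inE.
  congr (_ * _)%E.
    by apply: eq_bigr => i iA; rewrite KA.
  by apply: eq_bigr => i iB; rewrite KB.
have fin G : measurable G -> P G \is a fin_num by move=> mG; exact: fin_num_measure.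
have H1 G H : <<s cylinder A>> G -> cylinder B H -> P (G `&` H) = (P G * P H)%E.
  move=> sG cH; have mH := cylinder_measurable cH.
  pose c := NngNum (fine_ge0 (measure_ge0 P H)).
  have cE : (c%:num)%:E = P H by exact: fineK (fin _ mH).
  transitivity (mscale c P G); last first.
    by rewrite /mscale cE muleC.
  change (mrestr P mH G = mscale c P G).
  apply: (@g_sigma_algebra_measure_unique _ _ _ (cylinder A) _ (fun=> setT)) => //.
  - exact: cylinder_measurable.
  - by move=> _; exact: cylinderT.
  - by apply/seteqP; split => // w _; exists 0%N.
  - exact: cylinderI.
  - by move=> G' cG'; change (P (G' `&` H) = mscale c P G'); rewrite /mscale cE muleC H0.
  - move=> _; rewrite /mrestr /=; apply: (@le_lt_trans _ _ (P setT)); last by rewrite probability_setT ltry.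
    by apply: le_measure; rewrite ?inE//; exact: measurableI.
move=> sE sF; have mE := block_measurable sE.
pose c := NngNum (fine_ge0 (measure_ge0 P E)).
have cE : (c%:num)%:E = P E by exact: fineK (fin _ mE).
transitivity (mscale c P F); last first.
  by rewrite /mscale cE.
rewrite setIC; change (mrestr P mE F = mscale c P F).
apply: (@g_sigma_algebra_measure_unique _ _ _ (cylinder B) _ (fun=> setT)) => //.
- exact: cylinder_measurable.
- by move=> _; exact: cylinderT.
- by apply/seteqP; split => // w _; exists 0%N.
- exact: cylinderI.
- by move=> G' cG'; change (P (G' `&` E) = mscale c P G'); rewrite /mscale cE setIC H1.
- move=> _; rewrite /mrestr /=; apply: (@le_lt_trans _ _ (P setT)); last by rewrite probability_setT ltry.
  by apply: le_measure; rewrite ?inE//; exact: measurableI.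
Qed.

(** The law of the pair agrees with the product law on rectangles by block independence. The
    iterated integral uses two copies of the same space [Om]. *)
Lemma block_tonelli A B (U V : Om -> R) (f : R * R -> \bar R) : disjoint (mem A) (mem B) ->
  measurable_fun [set: block A] (U : block A -> R) ->
  measurable_fun [set: block B] (V : block B -> R) ->
  measurable_fun setT f -> (forall x, 0 <= f x)%E ->
  (\int[P]_w f (U w, V w) = \int[P]_w \int[P]_w' f (U w, V w'))%E.
Proof.
move=> dAB mU mV mf f0.
have mU' := block_fun_measurable mU; have mV' := block_fun_measurable mV.
pose UR : {RV P >-> R} := mfun_Sub (mem_set mU').
pose VR : {RV P >-> R} := mfun_Sub (mem_set mV').
have mUV : measurable_fun setT (fun w => (U w, V w)) by exact: measurable_fun_pair.
pose UVR : {RV P >-> (R * R)%type} := mfun_Sub (mem_set mUV).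
transitivity (\int[distribution P UVR]_z f z)%E.
  by rewrite ge0_integral_distribution.
transitivity (\int[distribution P UR \x distribution P VR]_z f z)%E.
  apply/esym/eq_measure_integral => Y mY _.
  apply: (@product_measure_unique _ _ _ _ _ (distribution P UR) (distribution P VR)
    (distribution P UVR)) => // C D mC mD.
  change (P ((U @^-1` C) `&` (V @^-1` D)) = P (U @^-1` C) * P (V @^-1` D))%E.
  apply: (block_independent dAB).
    by have := mU measurableT C mC; rewrite setTI.
  by have := mV measurableT D mD; rewrite setTI.
rewrite fubini_tonelli1// ge0_integral_distribution//=; first last.
- by move=> x; apply: integral_ge0.
- exact: measurable_fun_fubini_tonelli_F.
apply: eq_integral => w _ /=.
rewrite /fubini_F ge0_integral_distribution//.
exact: measurable_fun_pair2.
Qed.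
End blocks.

Section blocks2.
Context d (Om : measurableType d) (R : realType) (P : probability Om R).
Context (I : finType) (X : I -> Om -> R).
Hypothesis mX : forall i, measurable_fun setT (X i).
Hypothesis indX : mutually_independent P X.
Implicit Types (A B : {set I}) (E F : set Om).
Local Notation gam := (@normal_prob R 0 1).
Local Notation block A := (g_sigma_algebraType (cylinder X A)).

Lemma measurable_block_sum A (r : seq I) (c : I -> R) : {subset r <= A} ->
  measurable_fun [set: block A] ((fun w => \sum_(i <- r) c i * X i w) : block A -> R).
Proof.
elim: r => [|i r IH] rA.
  by under eq_fun do rewrite big_nil; exact: measurable_cst.
under eq_fun do rewrite big_cons.
apply: measurable_funD.
  apply: measurable_funM => //; apply: measurable_block_coord => //.
  by apply: rA; rewrite mem_head.
by apply: IH => j jr; apply: rA; rewrite inE jr orbT.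
Qed.

(** Induction on the list: the head is independent of the remaining block, and rotation merges the
    two standard deviations. *)
Lemma gauss_law_sum (r : seq I) (c : I -> R) : uniq r ->
  (forall i, gauss_law P (X i) 1) ->
  gauss_law P (fun w => \sum_(i <- r) c i * X i w) (Num.sqrt (\sum_(i <- r) c i ^+ 2)).
Proof.
move=> ur gX; elim: r ur => [_|i r IH /= /andP[ir ur]] f mf f0.
  rewrite big_nil sqrtr0.
  under eq_integral do rewrite big_nil.
  under [RHS]eq_integral do rewrite mul0r.
  by rewrite !integral_cst//= !probability_setT.
under eq_integral do rewrite big_cons.
pose F (w : R * R) := f (c i * w.1 + w.2).
have mF : measurable_fun setT F.
  by apply: measurableT_comp => //; apply: measurable_funD => //; exact: measurable_funM.
have F0 w : (0 <= F w)%E by exact: f0.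
pose S w := \sum_(j <- r) c j * X j w.
set t := Num.sqrt (\sum_(j <- r) c j ^+ 2) in IH.
transitivity (\int[P]_w F (X i w, S w))%E; first by [].
have ii : i \in [set i]%SET by rewrite inE.
rewrite (@block_tonelli _ _ _ P _ X mX indX [set i]%SET [set j in r]%SET (X i) S F)//; first last.
- by apply: measurable_block_sum => j jr; rewrite inE.
- exact: measurable_block_coord.
- by rewrite disjoints1 inE.
under eq_integral => w _.
  rewrite (IH ur (fun y => F (X i w, y)))//; last first.
    exact: (@measurable_fun_pair2 _ _ _ _ _ _ F).
  over.
pose G x := (\int[gam]_y F (x, (t * y)%R))%E.
have mG : measurable_fun setT G.
  have mF' : measurable_fun setT (fun w : R * R => F (w.1, t * w.2)).
    apply: measurableT_comp => //; apply: measurable_fun_pair => //.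
    exact: measurable_funM.
  exact: (@measurable_fun_fubini_tonelli_F _ _ _ _ _ gam _ mF' (fun=> F0 _)).
have G0 x : (0 <= G x)%E by apply: integral_ge0.
rewrite (gX i G mG G0).
under eq_integral do rewrite /G /F /= mul1r.
rewrite ge0_integral_gauss_rot//; apply: eq_integral => z _.
by rewrite big_cons sqr_sqrtr// sumr_ge0// => j _; exact: sqr_ge0.
Qed.

Lemma block_prod (J : finType) (A : J -> {set I}) (U : J -> Om -> R) (r : seq J) :
  (forall j k, j != k -> disjoint (mem (A j)) (mem (A k))) ->
  (forall j, measurable_fun [set: block (A j)] (U j : block (A j) -> R)) ->
  (forall j w, 0 <= U j w) -> uniq r ->
  (\int[P]_w (\prod_(j <- r) U j w)%:E = \prod_(j <- r) \int[P]_w (U j w)%:E)%E.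
Proof.
move=> dA mU U0; elim: r => [_|j r IH /= /andP[jr ur]].
  by under eq_integral do rewrite big_nil; rewrite big_nil integral_cst//= probability_setT mule1.
under eq_integral do rewrite big_cons.
rewrite big_cons -IH//.
pose B := (\bigcup_(k in [set k in r]) A k)%SET.
pose V w := \prod_(k <- r) U k w.
have sub k : k \in r -> cylinder X (A k) `<=` cylinder X B.
  move=> kr _ [C mC ->]; exists (fun i => if i \in A k then C i else setT).
    by move=> i; case: ifP.
  apply/seteqP; split => w /= h i /=.
    by move=> _; case: ifPn => // ik; exact: h.
  by move=> ik; have := h i; rewrite /= ik; apply; apply/bigcupP; exists k; rewrite ?inE.
have mUB k : k \in r -> measurable_fun [set: block B] (U k : block B -> R).
  move=> kr _ Y mY; have := mU k measurableT Y mY.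
  by apply: sub_smallest2r; [exact: smallest_sigma_algebra|exact: sub].
have mV : measurable_fun [set: block B] (V : block B -> R).
  suff H s : {subset s <= r} ->
      measurable_fun [set: block B] ((fun w => \prod_(k <- s) U k w) : block B -> R).
    exact: H.
  elim: s => [|k s IHs] sr.
    by under eq_fun do rewrite big_nil; exact: measurable_cst.
  under eq_fun do rewrite big_cons.
  apply: measurable_funM; first by apply: mUB; apply: sr; rewrite mem_head.
  by apply: IHs => l ls; apply: sr; rewrite inE ls orbT.
have V0 w : 0 <= V w by apply: prodr_ge0.
(* Tonelli asks for a function nonnegative on the whole plane; the absolute values provide this and
   vanish on the actual, nonnegative factors. *)
pose f (w : R * R) := (`|w.1| * `|w.2|)%:E.
have mf : measurable_fun setT f.
  by apply/measurable_EFinP; apply: measurable_funM; apply: measurableT_comp.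
transitivity (\int[P]_w f (U j w, V w))%E.
  by apply: eq_integral => w _; rewrite /f /= !ger0_norm.
have mU' := block_fun_measurable mX (mU j).
have mV' := block_fun_measurable mX mV.
rewrite (@block_tonelli _ _ _ P _ X mX indX (A j) B (U j) V f)//; last 2 first.
- apply/bigcup_disjointP => k; rewrite inE => kr.
  by apply: dA; apply: contraNneq jr => ->.
- by move=> w; rewrite /f lee_fin mulr_ge0.
rewrite -ge0_integralZr//; first last.
- by apply: integral_ge0 => w _; rewrite lee_fin; exact: V0.
- by move=> w _; rewrite lee_fin; exact: U0.
- exact/measurable_EFinP.
apply: eq_integral => w _.
rewrite -ge0_integralZl//; first last.
- by rewrite lee_fin; exact: U0.
- by move=> v _; rewrite lee_fin; exact: V0.
- exact/measurable_EFinP.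
by apply: eq_integral => v _; rewrite /f /= !ger0_norm// EFinM.
Qed.
End blocks2.

(** * Independent standard Gaussian rows and Chernoff bounds *)

Section rows.
Context d (Om : measurableType d) (R : realType) (P : probability Om R).
Local Notation gam := (@normal_prob R 0 1).

(** Independence and normality enter as the factorisation of exponential moments, the form Chernoff
    bounds consume; [F] may vary with the coordinate, to cover shifts and restrictions to
    subsets. *)
Definition iid_gauss (J : finType) (U : J -> Om -> R) :=
  (forall j, measurable_fun setT (U j)) /\
  forall F : J -> R -> R, (forall j, measurable_fun setT (F j)) ->
  (\int[P]_w (expR (\sum_j F j (U j w)))%:E = \prod_j \int[gam]_z (expR (F j z))%:E)%E.

(** The rows are disjoint blocks and a contrast of unit norm keeps variance one. It serves both the
    CUSUM contrast at [v] and the normalised difference of two of them. *)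
Lemma iid_gauss_rows (p n : nat) (Y : 'I_p * 'I_n -> Om -> R) (c : 'I_n -> R) :
  (forall i, measurable_fun setT (Y i)) -> mutually_independent P Y ->
  (forall i, gauss_law P (Y i) 1) -> \sum_t c t ^+ 2 = 1 ->
  iid_gauss (fun i w => \sum_t c t * Y (i, t) w).
Proof.
move=> mY iY gY c1.
pose r (i : 'I_p) := [seq (i, t) | t <- index_enum 'I_n].
pose c' (it : 'I_p * 'I_n) := c it.2.
have UE i w : \sum_t c t * Y (i, t) w = \sum_(it <- r i) c' it * Y it w.
  by rewrite big_map.
pose A i := [set it : 'I_p * 'I_n | it.1 == i]%SET.
have mU i : measurable_fun [set: g_sigma_algebraType (cylinder Y (A i))]
   ((fun w => \sum_t c t * Y (i, t) w) : g_sigma_algebraType (cylinder Y (A i)) -> R).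
  under eq_fun do rewrite UE.
  by apply: measurable_block_sum => _ /mapP[t _ ->]; rewrite inE.
split=> [i|F mF]; first exact: (block_fun_measurable mY (mU i)).
under eq_integral do rewrite expR_sum.
rewrite (@block_prod _ _ _ P _ Y mY iY _ A (fun j w => expR (F j (\sum_t c t * Y (j, t) w))))//.
- apply: eq_bigr => i _; under eq_integral do rewrite UE.
  have ur : uniq (r i) by rewrite map_inj_uniq ?index_enum_uniq// => ? ? [].
  rewrite (@gauss_law_sum _ _ _ P _ Y mY iY (r i) c' ur gY (fun x => (expR (F i x))%:E)).
  + apply: eq_integral => z _; rewrite big_map c1.
    by rewrite sqrtr1 mul1r.
  + by apply/measurable_EFinP; apply: measurableT_comp.
  + by move=> x; rewrite lee_fin expR_ge0.
- move=> i k ik; rewrite finset.disjoints_subset; apply/fintype.subsetP => it; rewrite !inE => /eqP ->.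
  by [].
- by move=> i; apply: measurableT_comp => //; apply: measurableT_comp.
- exact: index_enum_uniq.
Qed.

(** Chernoff with parameter 1; any tilt is absorbed into [F]. *)
Lemma iid_gauss_chernoff (J : finType) (U : J -> Om -> R) (F : J -> R -> R) (b : J -> R) x :
  iid_gauss U -> (forall j, measurable_fun setT (F j)) ->
  (forall j, \int[gam]_z (expR (F j z))%:E <= (expR (b j))%:E)%E ->
  (P [set w | x <= \sum_j F j (U j w)]%R <= (expR (\sum_j b j - x))%:E)%E.
Proof.
move=> [mU UE] mF Fb.
have mS : measurable_fun setT (fun w => \sum_j F j (U j w)).
  by apply: measurable_sum => j; exact: measurableT_comp.
pose S : {RV P >-> R} := mfun_Sub (mem_set mS).
have := @chernoff _ _ _ P S 1 x ltr01.
rewrite /mmt_gen_fun mul1r unlock /= => /le_trans; apply.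
rewrite expRD EFinM lee_wpmul2r ?lee_fin ?expR_ge0//.
under eq_integral do rewrite /= mulr1.
rewrite UE// expR_sum -prodEFin.
apply: (proj2 (_ : (0%R <= _)%E /\ (_ <= _)%E)).
apply: (big_ind2 (fun x y : \bar R => (0 <= x)%E /\ (x <= y)%E)) => //.
- move=> x1 x2 y1 y2 [x10 x12] [y10 y12]; split; first exact: mule_ge0.
  exact: lee_pmul.
- by move=> j _; split => //; apply: integral_ge0 => z _; rewrite lee_fin expR_ge0.
Qed.
End rows.

(** * One-dimensional Gaussian inequalities *)

Section real_ineq.
Context {R : realType}.
Implicit Types x y : R.

Lemma expR_taylor2 y : expR y <= 1 + y + y ^+ 2 * expR `|y|.
Proof.
have e1 : expR y * (1 - y) <= 1.
  have := expR_ge1Dx (- y) => h.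
  rewrite -[leRHS](expRxMexpNx_1 y) ler_wpM2l ?expR_ge0//.
have e2 : expR y - 1 <= y * expR y by move: e1; rewrite mulrBr mulr1 (mulrC y); lra.
have := expR_ge1Dx y => e3.
case: (leP 0 y) => y0.
  rewrite ger0_norm//.
  have : y * (expR y - 1) <= y * (y * expR y) by rewrite ler_wpM2l.
  by rewrite expr2; nra.
rewrite ltr0_norm//.
have e4 : 1 <= expR (- y) by rewrite -expR0 ler_expR; lra.
have : (- y) * (1 - expR y) <= (- y) * (- y) by rewrite ler_wpM2l; lra.
have : y ^+ 2 <= y ^+ 2 * expR (- y) by rewrite ler_peMr// sqr_ge0.
by rewrite expr2; nra.
Qed.

Lemma sqr_le_expR x : 0 <= x -> x ^+ 2 <= 4 * expR x.
Proof.
move=> x0; have := expR_ge1Dx (x / 2) => h.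
have -> : expR x = expR (x / 2) ^+ 2 by rewrite expr2 -expRD -splitr.
have : (1 + x / 2) ^+ 2 <= expR (x / 2) ^+ 2 by rewrite ler_sqr// nnegrE ?expR_ge0//; lra.
by rewrite !expr2; nra.
Qed.
End real_ineq.

(** * Calculus of finite Gaussian integrals *)

Section gauss_integrals.
Context {R : realType}.
Local Notation gam := (@normal_prob R 0 1).
Implicit Types f g : R -> R.

(** Measurability, nonnegativity and value travel together, so an inequality between expectations
    follows from a pointwise one by [gauss_int_le]. *)
Definition gauss_int f v :=
  [/\ measurable_fun setT f, (forall x, 0 <= f x) & (\int[gam]_x (f x)%:E = v%:E)%E].

Lemma gauss_intD f g u v : gauss_int f u -> gauss_int g v ->
  gauss_int (fun x => f x + g x) (u + v).
Proof.
move=> [mf f0 fu] [mg g0 gv]; split; first exact: measurable_funD.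
  by move=> x; rewrite addr_ge0.
under eq_integral do rewrite EFinD.
rewrite ge0_integralD//.
- by rewrite fu gv.
- by move=> x _; rewrite lee_fin.
- exact/measurable_EFinP.
- by move=> x _; rewrite lee_fin.
- exact/measurable_EFinP.
Qed.

Lemma gauss_intZ f c v : 0 <= c -> gauss_int f v -> gauss_int (fun x => c * f x) (c * v).
Proof.
move=> c0 [mf f0 fu]; split; first exact: measurable_funM.
  by move=> x; rewrite mulr_ge0.
under eq_integral do rewrite EFinM.
rewrite ge0_integralZl//.
- by rewrite fu.
- exact/measurable_EFinP.
- by move=> x _; rewrite lee_fin.
Qed.

Lemma gauss_int_cst c : 0 <= c -> gauss_int (fun=> c) c.
Proof.
move=> c0; split => //.
by rewrite integral_cst//= probability_setT mule1.
Qed.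

Lemma gauss_int_ge0 f v : gauss_int f v -> 0 <= v.
Proof.
by move=> [mf f0 fv]; rewrite -lee_fin -fv integral_ge0// => x _; rewrite lee_fin.
Qed.

Lemma gauss_int_le f g u v : gauss_int f u -> gauss_int g v -> (forall x, f x <= g x) ->
  u <= v.
Proof.
move=> [mf f0 fu] [mg g0 gv] fg; rewrite -lee_fin -fu -gv.
apply: ge0_le_integral => //.
- by move=> x _; rewrite lee_fin.
- exact/measurable_EFinP.
- exact/measurable_EFinP.
- by move=> x _; rewrite lee_fin.
Qed.

Lemma gauss_int_dom f g v : gauss_int g v -> measurable_fun setT f ->
  (forall x, 0 <= f x <= g x) -> exists u, gauss_int f u.
Proof.
move=> [mg g0 gv] mf fg.
have f0 x : 0 <= f x by have /andP[] := fg x.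
have fle : (\int[gam]_x (f x)%:E <= v%:E)%E.
  rewrite -gv; apply: ge0_le_integral => //.
  - by move=> x _; rewrite lee_fin.
  - exact/measurable_EFinP.
  - exact/measurable_EFinP.
  - by move=> x _; rewrite lee_fin; have /andP[] := fg x.
exists (fine (\int[gam]_x (f x)%:E)%E); split => //.
rewrite fineK// ge0_fin_numE; first by rewrite (le_lt_trans fle)// ltry.
by apply: integral_ge0 => x _; rewrite lee_fin.
Qed.

Lemma gauss_int_expR_sqr s : 0 < s ->
  gauss_int (fun x => expR ((1 - s ^- 2) / 2 * x ^+ 2)) s.
Proof.
move=> s0; split.
- by apply: measurableT_comp => //; apply: measurable_funM => //; exact: measurable_funX.
- by move=> x; exact: expR_ge0.
- exact: integral_gauss_sqr.
Qed.

Lemma gauss_int_expR38 : gauss_int (fun x => expR (3 / 8 * x ^+ 2)) 2.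
Proof.
have := gauss_int_expR_sqr (ltr0n R 2).
by have -> : (1 - 2 ^- 2) / 2 = 3 / 8 :> R by field.
Qed.

Lemma gauss_int_expR1532 : gauss_int (fun x => expR (15 / 32 * x ^+ 2)) 4.
Proof.
have := gauss_int_expR_sqr (ltr0n R 4).
by have -> : (1 - 4 ^- 2) / 2 = 15 / 32 :> R by field.
Qed.

Lemma measurable_sqr : measurable_fun setT (fun x : R => x ^+ 2).
Proof. exact: measurable_funX. Qed.

(* The second moment is read off the slope at [c = 0] of [E (expR (c * Z ^+ 2))], through
   [1 + c * Z ^+ 2 <= expR (c * Z ^+ 2)] for [c] of both signs. *)
Lemma gauss_int_sqr : gauss_int (fun x => x ^+ 2) 1.
Proof.
have [M HM] : exists M, gauss_int (fun x => x ^+ 2) M.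
  have h83 : 0 <= 8 / 3 :> R by lra.
  apply: (gauss_int_dom (gauss_intZ h83 gauss_int_expR38) measurable_sqr).
  move=> x; rewrite sqr_ge0/=; have := expR_ge1Dx (3 / 8 * x ^+ 2); lra.
have M0 := gauss_int_ge0 HM.
have key s : 0 < s -> (s ^+ 2 - 1) * M <= 2 * s ^+ 2 * (s - 1).
  move=> s0; pose c := (1 - s ^- 2) / 2.
  have ic := gauss_int_expR_sqr s0; rewrite -/c in ic.
  (* Positive and negative parts of [c] are put on opposite sides, which keeps both integrands
     nonnegative for either sign. *)
  have cE : Num.max c 0 = c + Num.max (- c) 0.
    by rewrite /Num.max; case: ifPn; case: ifPn; rewrite -?leNgt => *; lra.
  have pt x : 1 + Num.max c 0 * x ^+ 2 <= expR (c * x ^+ 2) + Num.max (- c) 0 * x ^+ 2.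
    by have := expR_ge1Dx (c * x ^+ 2); rewrite cE mulrDl; lra.
  have max0 y : 0 <= Num.max y 0 :> R by rewrite le_max lexx orbT.
  have := gauss_int_le (gauss_intD (gauss_int_cst ler01) (gauss_intZ (max0 c) HM))
    (gauss_intD ic (gauss_intZ (max0 (- c)) HM)) pt.
  rewrite cE mulrDl.
  move=> h; have {}h : c * M <= s - 1 by lra.
  have -> : (s ^+ 2 - 1) * M = 2 * s ^+ 2 * (c * M) by rewrite /c; field; rewrite gt_eqF.
  by rewrite ler_wpM2l// mulr_ge0// sqr_ge0.
suff -> : 1 = M by [].
apply/eqP; rewrite eq_le; apply/andP; split; rewrite leNgt; apply/negP => M1.
(* [key] at [s = 1 - e] refutes [M < 1], and at [s = 1 + e] it refutes [M > 1]; [e] is a fraction of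
   the gap, so second-order terms cannot make up for it. *)
- pose e := (1 - M) / 3.
  have e0 : 0 < e by rewrite /e; lra.
  have : 0 < 1 - e by rewrite /e; lra.
  move=> /key; rewrite !expr2; have : M = 1 - 3 * e by rewrite /e; lra.
  move=> ->; have : 0 < e * e by nra.
  have : e < 1 / 2 by rewrite /e; lra.
  have : 0 < e * e * e by apply: mulr_gt0 => //; apply: mulr_gt0.
  nra.
- pose e := Num.min (1 / 2) ((M - 1) / 4).
  have e0 : 0 < e by rewrite /e lt_min; apply/andP; split; lra.
  have e1 : e <= 1 / 2 by rewrite /e ge_min lexx.
  have eM : 1 + 4 * e <= M.
    have : e <= (M - 1) / 4 by rewrite /e ge_min lexx orbT.
    lra.
  have : 0 < 1 + e by lra.
  move=> /key; rewrite !expr2 => k.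
  have : (2 * e + e * e) * (1 + 4 * e) <= (2 * e + e * e) * M by rewrite ler_wpM2l//; nra.
  nra.
Qed.

End gauss_integrals.

(** * Thresholded squares and their centering *)

Section threshold.
Context {R : realType}.
Local Notation gam := (@normal_prob R 0 1).
Implicit Types a x z s : R.

Definition thr a x : R := if a <= `|x| then x ^+ 2 - nu a else 0.
Definition ind a x : R := (a <= `|x|)%R%:R.
Definition mass a : R := fine (gam [set x : R | a <= `|x|]).

Lemma measurable_absge a : measurable [set x : R | a <= `|x|].
Proof.
rewrite [X in measurable X](_ : _ = (fun x : R => `|x|) @^-1` `[a, +oo[%classic); last first.
  by apply/seteqP; split => x /=; rewrite in_itv/= andbT.
by rewrite -[X in measurable X]setTI; apply: measurableT_comp.
Qed.

Lemma indE a : ind a = \1_[set x : R | a <= `|x|].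
Proof.
apply/funext => x; rewrite /ind indicE.
suff -> : (x \in [set x : R | a <= `|x|]) = (a <= `|x|) by [].
by apply/idP/idP; rewrite inE.
Qed.

Lemma thrE a x : thr a x = (x ^+ 2 - nu a) * ind a x.
Proof. by rewrite /thr /ind; case: ifP => _; rewrite ?mulr1 ?mulr0. Qed.

Lemma ind_ge0 a x : 0 <= ind a x. Proof. exact: ler0n. Qed.

Lemma ind_le1 a x : ind a x <= 1.
Proof. by rewrite /ind -[leRHS]/(1%:R) ler_nat leq_b1. Qed.

Lemma measurable_ind a : measurable_fun setT (ind a).
Proof. by rewrite indE; apply: measurable_indic; exact: measurable_absge. Qed.

Lemma measurable_thr a : measurable_fun setT (thr a).
Proof.
rewrite (_ : thr a = fun x => (x ^+ 2 - nu a) * ind a x); last by apply/funext => x; rewrite thrE.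
apply: measurable_funM; last exact: measurable_ind.
by apply: measurable_funB => //; exact: measurable_sqr.
Qed.

Lemma gauss_int_ind a : gauss_int (ind a) (mass a).
Proof.
split; [exact: measurable_ind|exact: ind_ge0|].
rewrite indE integral_indic//; last exact: measurable_absge.
by rewrite setIT /mass fineK// fin_num_measure//; exact: measurable_absge.
Qed.

Lemma normal_peak1_ge : 1 / 3 <= normal_peak (1 : R).
Proof.
rewrite /normal_peak expr1n !mul1r lef_pV2 ?posrE//; last first.
  by rewrite sqrtr_gt0 pmulrn_lgt0// pi_gt0.
have -> : 3 = Num.sqrt (3 ^+ 2) :> R by rewrite sqrtr_sqr ger0_norm.
rewrite ler_sqrt ?sqr_ge0//; have := pihalf_lt2 R; lra.
Qed.

(** Integrate the density over [[a, a + 1]] only; [1/3] is a lower bound for [1 / sqrt (2 pi)]. *)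
Lemma mass_ge a : 0 <= a -> 1 / 3 * expR (- (a + 1) ^+ 2 / 2) <= mass a.
Proof.
move=> a0; rewrite -lee_fin.
rewrite /mass fineK ?fin_num_measure//; last exact: measurable_absge.
pose c := (1 / 3 * expR (- (a + 1) ^+ 2 / 2)).
apply: (@le_trans _ _ (\int[lebesgue_measure]_(x in `[a, (a + 1)%R]) (cst c%:E x))%E).
  rewrite integral_cst//= lebesgue_measure_itv/= lte_fin ltrDl ltr01 -EFinB -EFinM lee_fin.
  by rewrite /c; lra.
rewrite /normal_prob.
apply: (@le_trans _ _ (\int[lebesgue_measure]_(x in `[a, (a + 1)%R]) (normal_pdf 0 1 x)%:E)%E).
  apply: ge0_le_integral => //.
  - by move=> x _; rewrite lee_fin mulr_ge0// expR_ge0.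
  - by apply/measurable_EFinP/measurable_funTS; exact: measurable_normal_pdf.
  - move=> x /=; rewrite in_itv/= => /andP[ax xa]; rewrite lee_fin std_pdfE.
    apply: ler_pM; rewrite ?expR_ge0//; first exact: normal_peak1_ge.
    by rewrite ler_expR; rewrite !expr2; nra.
apply: ge0_subset_integral => //.
- exact: measurable_absge.
- by apply/measurable_EFinP/measurable_funTS; exact: measurable_normal_pdf.
- by move=> x _; rewrite lee_fin normal_pdf_ge0.
- by move=> x /=; rewrite in_itv/= => /andP[ax _]; rewrite ger0_norm//; lra.
Qed.

Lemma mass_gt0 a : 0 <= a -> 0 < mass a.
Proof. by move=> /mass_ge; apply: lt_le_trans; rewrite mulr_gt0 ?expR_gt0//; lra. Qed.

Lemma gauss_int_sqr_ind a : 0 <= a -> gauss_int (fun x => x ^+ 2 * ind a x) (nu a * mass a).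
Proof.
move=> a0.
have [v Hv] : exists v, gauss_int (fun x => x ^+ 2 * ind a x) v.
  apply: (gauss_int_dom gauss_int_sqr).
    by apply: measurable_funM; [exact: measurable_sqr|exact: measurable_ind].
  move=> x; rewrite mulr_ge0 ?sqr_ge0 ?ind_ge0//= ler_piMr ?sqr_ge0//.
  exact: ind_le1.
suff -> : nu a * mass a = v by [].
have [_ _ vE] := Hv.
rewrite /nu -/(mass a) divfK ?gt_eqF ?mass_gt0//.
rewrite -[RHS]/(fine v%:E) -vE; congr fine; rewrite integral_mkcond.
apply: eq_integral => x _; rewrite patchE indE indicE.
by case: ifP => _ /=; rewrite ?mulr1 ?mulr0.
Qed.

Lemma nu0 : nu 0 = 1 :> R.
Proof.
have h := gauss_int_sqr_ind (lexx 0).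
have i1 x : ind 0 x = 1 by rewrite /ind normr_ge0.
have m1 : mass 0 = 1.
  have [_ _ e] := gauss_int_ind 0; have [_ _ e1] := @gauss_int_cst R 1 ler01.
  have [] : (mass 0)%:E = 1%:E :> \bar R.
    by rewrite -e -e1; apply: eq_integral => x _; rewrite i1.
  by [].
have [_ _ e] := h; have [_ _ e1] := @gauss_int_sqr R.
have [] : (nu 0 * mass 0)%:E = 1%:E :> \bar R.
  by rewrite -e -e1; apply: eq_integral => x _; rewrite i1 mulr1.
by rewrite m1 mulr1.
Qed.

Lemma nu_ge a : 0 <= a -> a ^+ 2 <= nu a.
Proof.
move=> a0; rewrite -(ler_pM2r (mass_gt0 a0)).
apply: (gauss_int_le (gauss_intZ (sqr_ge0 a) (gauss_int_ind a)) (gauss_int_sqr_ind a0)) => x.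
rewrite /ind; case: (leP a `|x|) => ax; rewrite ?mulr0// !mulr1.
by rewrite -[leRHS]real_normK ?num_real// ler_sqr ?nnegrE.
Qed.

(** Cut at [|x| = 3a]. Below, [x^2 <= 9 a^2]; above, the moment of [exp (3/8 x^2)] leaves a
    contribution of order [exp (- 9/4 a^2)], which for [a >= 2] is a small multiple of [mass a]. *)
Lemma nu_le a : 2 <= a -> nu a <= 15 * a ^+ 2.
Proof.
move=> a2; have a0 : 0 <= a by lra.
have aa : 4 <= a ^+ 2 by rewrite expr2; nra.
pose e := expR (- (9 / 4) * a ^+ 2).
have e0 : 0 < e by exact: expR_gt0.
have pt x : x ^+ 2 * ind a x <= 9 * a ^+ 2 * ind a x + 8 * e * expR (3 / 8 * x ^+ 2).
  have p0 : 0 <= 8 * e * expR (3 / 8 * x ^+ 2) by rewrite !mulr_ge0 ?expR_ge0// ltW.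
  have [h|h] := leP (x ^+ 2) (9 * a ^+ 2).
    by rewrite ler_wpDr// ler_wpM2r ?ind_ge0.
  apply: (@le_trans _ _ (x ^+ 2)).
    by rewrite ler_piMr ?sqr_ge0//; exact: ind_le1.
  rewrite ler_wpDl ?mulr_ge0 ?ind_ge0 ?sqr_ge0//.
  rewrite -mulrA /e -expRD.
  have h1 := expR_ge1Dx (x ^+ 2 / 8).
  have : expR (x ^+ 2 / 8) <= expR (- (9 / 4) * a ^+ 2 + 3 / 8 * x ^+ 2).
    by rewrite ler_expR; lra.
  lra.
have h9 : 0 <= 9 * a ^+ 2 by rewrite mulr_ge0 ?sqr_ge0.
have h8 : 0 <= 8 * e by rewrite mulr_ge0// ltW.
have := gauss_int_le (gauss_int_sqr_ind a0)
  (gauss_intD (gauss_intZ h9 (gauss_int_ind a)) (gauss_intZ h8 gauss_int_expR38)) pt.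
have mg := mass_ge a0; have m0 := mass_gt0 a0.
have ee : e <= mass a * (3 * expR (- (9 / 2))).
  apply: (@le_trans _ _ (1 / 3 * expR (- (a + 1) ^+ 2 / 2) * (3 * expR (- (9 / 2))))).
    rewrite mulrACA -expRD (_ : 1 / 3 * 3 = 1) ?mul1r; last by lra.
    by rewrite ler_expR !expr2 in aa *; nra.
  by rewrite ler_wpM2r// mulr_ge0// expR_ge0.
have e5 : expR (- (9 / 2 : R)) <= 1 / 5.
  rewrite expRN (_ : 1 / 5 = 5^-1) ?div1r// lef_pV2 ?posrE ?expR_gt0//.
  have := expR_ge1Dx (9 / 2 : R); lra.
move=> h; rewrite -(ler_pM2r m0).
have : mass a * (3 * expR (- (9 / 2))) <= mass a * (3 * (1 / 5)).
  rewrite ler_wpM2l ?(ltW m0)//; lra.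
have : 4 * mass a <= a ^+ 2 * mass a by rewrite ler_wpM2r// ltW.
lra.
Qed.

End threshold.

Ltac nonneg := repeat (first [assumption | lazymatch goal with
  | |- is_true (0 <= _ ^+ _) => first [exact: sqr_ge0 | apply: exprn_ge0]
  | |- is_true (0 <= _ * _) => apply: mulr_ge0
  | |- is_true (0 <= _ + _) => apply: addr_ge0
  | |- is_true (0 <= expR _) => exact: expR_ge0
  | |- is_true (0 <= ind _ _) => exact: ind_ge0
  | |- is_true (0 <= _%:R) => exact: ler0n
  | |- is_true (0 <= 1) => exact: ler01
  end]).

(** * Exponential moments of the thresholded noise *)

Section mgf.
Context {R : realType}.
Local Notation gam := (@normal_prob R 0 1).
Implicit Types a x y z s m : R.

Lemma expR1_le4 : expR 1 <= 4 :> R.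
Proof.
have -> : 1 = 1 / 2 + 1 / 2 :> R by field.
rewrite expRD; have := expR_ge1Dx (- (1 / 2) : R) => h.
have := expRxMexpNx_1 (1 / 2 : R); have := expR_gt0 (1 / 2 : R).
set u := expR (1 / 2) in h *; set v := expR (- (1 / 2)) in h * => u0 uv.
have : u * (1 - 1 / 2) <= u * v by rewrite ler_wpM2l ?(ltW u0).
rewrite uv; nra.
Qed.

(** One-sided on purpose: it is applied to [s * thr_excess], which is bounded above but not
    below. *)
Lemma expR_le_quadratic y : y <= 1 -> expR y <= 1 + y + 4 * y ^+ 2.
Proof.
move=> y1.
have e1 : expR y * (1 - y) <= 1.
  have := expR_ge1Dx (- y) => h.
  by rewrite -[leRHS](expRxMexpNx_1 y) ler_wpM2l ?expR_ge0.
have e2 := expR_ge1Dx y.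
have e4 : expR y <= 4 by apply: le_trans expR1_le4; rewrite ler_expR.
rewrite expr2; have [y0|y0] := leP 0 y; last by nra.
have : y * expR y <= y * 4 by rewrite ler_wpM2l.
by move=> h; have : y * (y * expR y) <= y * (y * 4); [rewrite ler_wpM2l|nra].
Qed.

(** The alternative in the hypothesis is the one met by the model: thresholds are 0 in the dense
    range and satisfy [a^2 >= 4] in the sparse range. *)
Lemma thr_abs a x : a = 0 \/ 2 <= a -> `|thr a x| <= 15 * (x ^+ 2 + 1) * ind a x.
Proof.
move=> a02; rewrite thrE normrM (ger0_norm (ind_ge0 _ _)).
rewrite /ind; case: (leP a `|x|) => [ax|_]; last by rewrite !mulr0.
rewrite !mulr1; have x2 := sqr_ge0 x.
have nb : nu a = 1 \/ (a ^+ 2 <= nu a /\ nu a <= 15 * a ^+ 2 /\ a ^+ 2 <= x ^+ 2).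
  case: a02 => [a0|a2]; first by left; rewrite a0; exact: nu0.
  have a0 : 0 <= a := le_trans (ler0n R 2) a2.
  right; split; first exact: nu_ge.
  split; first exact: nu_le.
  by rewrite -(real_normK (num_real x)) ler_sqr ?nnegrE.
set n := nu a in nb *; clearbody n.
by rewrite ler_norml; case: nb => [->|[n1 [n2 n3]]]; apply/andP; split; lra.
Qed.

Lemma measurable_expthr a s : measurable_fun setT (fun x => expR (s * thr a x)).
Proof.
apply: measurableT_comp => //; apply: measurable_funM => //; exact: measurable_thr.
Qed.

(** As [480 = 15 * 32], the exponent [|s * thr a x|] is at most [(x^2 + 1) / 32], so the Taylor
    remainder grows no faster than [exp (3/32 x^2)]. Where [|x| >= a], the remaining
    [15/32 - 3/32 = 3/8] is traded for [exp (- 3/8 a^2)]. *)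
Lemma thr_pointwise a s x : a = 0 \/ 2 <= a -> `|s| <= 1 / 480 ->
  (s * thr a x) ^+ 2 * expR `|s * thr a x| <=
  s ^+ 2 * ((7200 * 1024) * expR (- (3 / 8) * a ^+ 2)) * expR (15 / 32 * x ^+ 2).
Proof.
move=> a02 s1; have fa := thr_abs x a02; move: fa.
have R0 : 0 <= s ^+ 2 * ((7200 * 1024) * expR (- (3 / 8) * a ^+ 2)) * expR (15 / 32 * x ^+ 2).
  by nonneg.
rewrite /ind; case: (leP a `|x|) => [ax|_]; last first.
  by rewrite mulr0 normr_le0 => /eqP ->; rewrite mulr0 expr2 !mul0r.
rewrite mulr1; set f := thr a x => fx.
have x2 := sqr_ge0 x; have s2 := sqr_ge0 s.
set q := x ^+ 2 + 1 in fx *.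
have q0 : 0 <= q by rewrite /q; lra.
have f2 : f ^+ 2 <= 225 * q ^+ 2.
  have -> : 225 * q ^+ 2 = (15 * q) ^+ 2 by ring.
  by rewrite -(real_normK (num_real f)) ler_sqr ?nnegrE ?mulr_ge0.
have q2 : q ^+ 2 <= (128 * 128) * expR (q / 64).
  have := @sqr_le_expR _ (q / 64); rewrite divr_ge0// => /(_ isT).
  by rewrite expr_div_n; lra.
have sf : expR `|s * f| <= expR (q / 32).
  rewrite ler_expR normrM; have : `|s| * `|f| <= 1 / 480 * (15 * q) by apply: ler_pM.
  lra.
have e34 : expR (3 / 64 * q) <= 2 * expR (3 / 32 * x ^+ 2).
  have h : expR (3 / 64) <= 2 :> R.
    have h1 := expR_ge1Dx (- (3 / 64) : R); have := expRxMexpNx_1 (3 / 64 : R).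
    have := expR_gt0 (3 / 64 : R).
    set u := expR (3 / 64); set v := expR (- (3 / 64)) in h1 * => u0 uv.
    have : u * (1 - 3 / 64) <= u * v by rewrite ler_wpM2l ?(ltW u0).
    rewrite uv; nra.
  have -> : 3 / 64 * q = 3 / 64 + 3 / 64 * x ^+ 2 by rewrite /q; lra.
  rewrite expRD ler_pM ?expR_ge0// ler_expR; lra.
have e35 : expR (3 / 32 * x ^+ 2) <= expR (- (3 / 8) * a ^+ 2) * expR (15 / 32 * x ^+ 2) \/ a < 0.
  have [a0|] := leP 0 a; last by right.
  left; rewrite -expRD ler_expR.
  have : a ^+ 2 <= x ^+ 2 by rewrite -(real_normK (num_real x)) ler_sqr ?nnegrE.
  lra.
case: e35 => [e35|an]; last by case: a02 => [a0|]; lra.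
have main : f ^+ 2 * expR `|s * f| <=
    7200 * 1024 * (expR (- (3 / 8) * a ^+ 2) * expR (15 / 32 * x ^+ 2)).
  apply: (@le_trans _ _ (225 * (128 * 128 * expR (q / 64)) * expR (q / 32))).
    apply: ler_pM; [exact: sqr_ge0|exact: expR_ge0| |exact: sf].
    by apply: (le_trans f2); rewrite ler_wpM2l.
  have -> : 225 * (128 * 128 * expR (q / 64)) * expR (q / 32) = 3600 * 1024 * expR (3 / 64 * q).
    have -> : expR (3 / 64 * q) = expR (q / 64) * expR (q / 32) by rewrite -expRD; congr expR; lra.
    by ring.
  lra.
have -> : (s * f) ^+ 2 * expR `|s * f| = s ^+ 2 * (f ^+ 2 * expR `|s * f|) by rewrite exprMn mulrA.
apply: (le_trans (ler_wpM2l s2 main)).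
rewrite le_eqVlt; apply/orP; left; apply/eqP.
by rewrite -!mulrA.
Qed.

(** The constant of [thr_pointwise] times the integral 4 of [exp (15/32 x^2)]. *)
Definition thr_const : R := 4 * 7200 * 1024.

Lemma thr_const_ge0 : 0 <= thr_const. Proof. by rewrite /thr_const; lra. Qed.

(** The centering by [nu a] kills the first-order term, leaving the integrated second-order
    remainder. Both signs of [s] are covered, hence both tails. *)
Lemma thr_mgf a s : a = 0 \/ 2 <= a -> `|s| <= 1 / 480 ->
  (\int[gam]_z (expR (s * thr a z))%:E <=
   (expR (thr_const * s ^+ 2 * expR (- (3 / 8) * a ^+ 2)))%:E)%E.
Proof.
move=> a02 s1.
have a0 : 0 <= a by case: a02 => [->//|]; lra.
set B := s ^+ 2 * ((7200 * 1024) * expR (- (3 / 8) * a ^+ 2)).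
have B0 : 0 <= B by rewrite /B; nonneg.
pose sp := Num.max s 0; pose sn := Num.max (- s) 0.
have spn : sp = s + sn.
  by rewrite /sp /sn /Num.max; case: ifPn; case: ifPn; rewrite -?leNgt => *; lra.
have sp0 : 0 <= sp by rewrite /sp le_max lexx orbT.
have sn0 : 0 <= sn by rewrite /sn le_max lexx orbT.
have pt x : expR (s * thr a x) <= 1 + s * thr a x + B * expR (15 / 32 * x ^+ 2).
  apply: (le_trans (expR_taylor2 _)); rewrite lerD2l; exact: thr_pointwise.
have n0 : 0 <= nu a by rewrite (le_trans _ (nu_ge a0))// sqr_ge0.
have iI := gauss_int_ind a; have iS := gauss_int_sqr_ind a0.
have pt2 x : expR (s * thr a x) + (sp * nu a * ind a x + sn * (x ^+ 2 * ind a x)) <=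
   1 + B * expR (15 / 32 * x ^+ 2) + (sp * (x ^+ 2 * ind a x) + sn * nu a * ind a x).
  by have := pt x; rewrite thrE spn; lra.
have iR := gauss_intD (gauss_intD (gauss_int_cst ler01) (gauss_intZ B0 gauss_int_expR1532))
  (gauss_intD (gauss_intZ sp0 iS) (gauss_intZ (mulr_ge0 sn0 n0) iI)).
have iL := gauss_intD (gauss_intZ (mulr_ge0 sp0 n0) iI) (gauss_intZ sn0 iS).
have [v iv] : exists v, gauss_int (fun x => expR (s * thr a x)) v.
  apply: (gauss_int_dom iR (measurable_expthr a s)) => x.
  rewrite expR_ge0/=; apply: le_trans (pt2 x).
  by rewrite lerDl; nonneg.
have := gauss_int_le (gauss_intD iv iL) iR pt2.
have [_ _ ->] := iv; rewrite lee_fin => h.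
have : v <= 1 + B * 4 by lra.
move=> /le_trans; apply.
have -> : thr_const * s ^+ 2 * expR (- (3 / 8) * a ^+ 2) = B * 4 by rewrite /B /thr_const; ring.
exact: expR_ge1Dx.
Qed.

End mgf.

(** * Shifted Gaussians and the excess of thresholding *)

Section anderson.
Context {R : realType}.
Local Notation gam := (@normal_prob R 0 1).
Implicit Types a x y z s m : R.

(** For [0 <= u <= w] the difference of the two sides factorises as
    [(e^w - e^u) (1 - e^-u e^-w)]. *)
Lemma cosh_mono x y : `|x| <= `|y| -> expR x + expR (- x) <= expR y + expR (- y).
Proof.
have sym z : expR z + expR (- z) = expR `|z| + expR (- `|z|).
  by case: (leP 0 z) => z0; [rewrite ger0_norm|rewrite ltr0_norm// opprK addrC].
move=> xy; rewrite (sym x) (sym y); move: xy (normr_ge0 x) (normr_ge0 y).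
move: `|x| `|y| => u w uw u0 w0.
have := expRxMexpNx_1 u; have := expRxMexpNx_1 w.
have UW : expR u <= expR w by rewrite ler_expR.
have u1 : expR (- u) <= 1 by rewrite -expR0 ler_expR; lra.
have w1 : expR (- w) <= 1 by rewrite -expR0 ler_expR; lra.
have := expR_ge0 (- u); have := expR_ge0 (- w).
move: (expR u) (expR w) (expR (- u)) (expR (- w)) UW u1 w1 => U W U' W' UW u1 w1 w2 u2 e1 e2.
have h : 0 <= (W - U) * (1 - U' * W').
  by apply: mulr_ge0; [lra|rewrite subr_ge0; apply: mulr_ile1].
have -> : W + W' = U + U' + (W - U) * (1 - U' * W').
  transitivity (U' + W - (W * W') * U' + (U * U') * W'); last by ring.
  by rewrite e1 e2; ring.
by rewrite lerDl.
Qed.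

Lemma gauss_integral_opp (f : R -> \bar R) : measurable_fun setT f -> (forall x, 0 <= f x)%E ->
  (\int[gam]_x f (- x)%R = \int[gam]_x f x)%E.
Proof.
move=> mf f0; have := @ge0_integral_gauss_rot R (-1) 0 f mf f0.
rewrite sqrrN expr1n expr0n addr0 sqrtr1.
under [X in _ = X -> _]eq_integral do rewrite mul1r.
move=> <-; apply: eq_integral => x _.
under eq_integral do rewrite mul0r addr0 mulN1r.
by rewrite integral_cst//= probability_setT mule1.
Qed.

Lemma gauss_int_expR_tilt m : gauss_int (fun x => expR (m * x - m ^+ 2 / 2)) 1.
Proof.
split.
- by apply: measurableT_comp => //; exact: measurable_affine.
- by move=> x; exact: expR_ge0.
have := @ge0_integral_gauss_shift R m (cst 1%E) (@measurable_cst _ _ _ _ _ _) (fun=> lee01).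
rewrite /= integral_cst//= mul1e probability_setT => ->.
by apply: eq_integral => x _; rewrite mul1e.
Qed.

(* Single crossing: the likelihood ratio of the symmetrized shift increases with [|z|] while [F]
   decreases, so both lie on opposite sides of a common level [k]. *)
Lemma gauss_anderson (F : R -> R) v m : gauss_int F v ->
  (forall x y, `|x| <= `|y| -> F y <= F x) ->
  (\int[gam]_x (F (m + x)%R)%:E <= v%:E)%E.
Proof.
move=> iF Fdec; have [mF F0 _] := iF.
have Fsym x : F (- x) = F x by apply/eqP; rewrite eq_le !Fdec ?normrN.
have mEF : measurable_fun setT (EFin \o F) by exact/measurable_EFinP.
have EF0 x : (0 <= (F x)%:E)%E by rewrite lee_fin.
pose ep z := expR (m * z - m ^+ 2 / 2).
pose em z := expR ((- m) * z - (- m) ^+ 2 / 2).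
have iep := gauss_int_expR_tilt m; have iem := gauss_int_expR_tilt (- m).
have bd e u : gauss_int e u -> exists w, gauss_int (fun z => F z * e z) w.
  move=> ie; apply: (gauss_int_dom (gauss_intZ (F0 0) ie)).
    by have [me _ _] := ie; exact: measurable_funM.
  move=> x; have [_ e0 _] := ie; rewrite mulr_ge0//= ler_wpM2r// Fdec// normr0.
  exact: normr_ge0.
have [u iu] := bd _ _ iep; have [u' iu'] := bd _ _ iem.
have uu : u = u'.
  have [mu0 u0 ue] := iu; have [_ _ ue'] := iu'.
  have [] : u%:E = u'%:E :> \bar R; last by [].
  rewrite -ue -ue' -gauss_integral_opp; first last.
  - by move=> x; rewrite lee_fin.
  - exact/measurable_EFinP.
  by apply: eq_integral => x _; rewrite Fsym sqrrN mulrN mulNr.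
pose G z := ep z + em z.
have GE z : G z = expR (- (m ^+ 2 / 2)) * (expR (m * z) + expR (- (m * z))).
  by rewrite /G /ep /em sqrrN !expRD mulNr; ring.
have Gmono x y : `|x| <= `|y| -> G x <= G y.
  move=> xy; rewrite !GE ler_wpM2l ?expR_ge0//; apply: cosh_mono.
  by rewrite !normrM ler_wpM2l.
have iG : gauss_int G (1 + 1) by exact: gauss_intD.
pose L := [set F z | z in [set z | G z <= 2]].
pose k := inf L.
have L0 : lbound L 0 by move=> _ [z _ <-].
have hL : L !=set0.
  exists (F 0); exists 0 => //=; rewrite GE mulr0 oppr0 expR0.
  have : expR (- (m ^+ 2 / 2)) <= 1 by rewrite -expR0 ler_expR oppr_le0 mulr_ge0 ?sqr_ge0.
  lra.
have k0 : 0 <= k by exact: lb_le_inf.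
(* This is [(F z - k) * (G z - 2) <= 0]; the level 2 is the mean of [G], so the terms in [k] cancel
   after integration. *)
have cross z : F z * G z + 2 * k <= 2 * F z + k * G z.
  have [Gz|Gz] := leP (G z) 2.
    have : k <= F z by apply: ge_inf; [exists 0|exists z].
    by move=> h; nra.
  have : F z <= k.
    apply: lb_le_inf => // _ [y Gy <-]; apply: Fdec.
    rewrite leNgt; apply/negP => /ltW /Gmono h.
    by move: (lt_le_trans Gz h); rewrite ltNge Gy.
  by move=> h; nra.
have h2 : 0 <= 2 :> R by [].
have h2k : 0 <= 2 * k by lra.
have := gauss_int_le (gauss_intD (gauss_intD iu iu') (gauss_int_cst h2k))
  (gauss_intD (gauss_intZ h2 iF) (gauss_intZ k0 iG)).
have pt x : F x * expR (m * x - m ^+ 2 / 2) + F x * expR (- m * x - (- m) ^+ 2 / 2) + 2 * k <=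
    2 * F x + k * G x.
  by have := cross x; rewrite /G /ep /em mulrDr.
move=> /(_ pt) h.
rewrite (@ge0_integral_gauss_shift R m (EFin \o F))//.
have [_ _ ue] := iu.
under eq_integral do rewrite /= -EFinM.
by rewrite ue lee_fin; lra.
Qed.

(** The thresholded term minus the centered square: [1 - nu a] above the threshold, [1 - x^2] below
    it. *)
Definition thr_excess a x : R := thr a x - (x ^+ 2 - 1).

Lemma measurable_thr_excess a : measurable_fun setT (thr_excess a).
Proof.
apply: measurable_funB; first exact: measurable_thr.
by apply: measurable_funB => //; exact: measurable_sqr.
Qed.

(** The only delicate point is the jump at [|x| = a], from [1 - a^2] to [1 - nu a]; it goes down
    because [nu a >= a^2]. *)
Lemma thr_excess_mono a x y : 0 <= a -> `|x| <= `|y| -> thr_excess a y <= thr_excess a x.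
Proof.
move=> a0 xy; have na := nu_ge a0; rewrite /thr_excess /thr.
have xy2 : x ^+ 2 <= y ^+ 2.
  by rewrite -(real_normK (num_real x)) -(real_normK (num_real y)) ler_sqr ?nnegrE.
case: (leP a `|y|) => ay; case: (leP a `|x|) => ax.
- lra.
- have : x ^+ 2 <= a ^+ 2 by rewrite -(real_normK (num_real x)) ler_sqr ?nnegrE// ltW.
  lra.
- by have := lt_le_trans ay (le_trans ax xy); rewrite ltxx.
- lra.
Qed.

Lemma thr_excess_sqr a x : a = 0 \/ 2 <= a -> thr_excess a x <= 1 /\ thr_excess a x ^+ 2 <= 225 * (x ^+ 2) ^+ 2 + 1.
Proof.
move=> a02; have x2 := sqr_ge0 x.
have x4 := sqr_ge0 (x ^+ 2).
rewrite /thr_excess /thr; case: (leP a `|x|) => ax; last first.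
  split; first lra.
  have -> : (0 - (x ^+ 2 - 1)) ^+ 2 = (x ^+ 2) ^+ 2 - 2 * x ^+ 2 + 1 by ring.
  lra.
have -> : x ^+ 2 - nu a - (x ^+ 2 - 1) = 1 - nu a by ring.
case: a02 => [->|a2].
  by rewrite nu0 subrr expr2 mul0r; split; lra.
have a0 : 0 <= a := le_trans (ler0n R 2) a2.
have n1 := nu_ge a0; have n2 := nu_le a2.
have aa : 4 <= a ^+ 2 by rewrite expr2; nra.
have ax2 : a ^+ 2 <= x ^+ 2 by rewrite -(real_normK (num_real x)) ler_sqr ?nnegrE.
split; first lra.
have : (1 - nu a) ^+ 2 <= (15 * x ^+ 2) ^+ 2.
  by rewrite -[leLHS]sqrrN ler_sqr ?nnegrE; lra.
lra.
Qed.

(** The outer 4 comes from [expR_le_quadratic]. Inside, [240^2 = 225 * 64 * 4]: the bound on the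
    squared excess, the price of trading [x^4] for [exp (15/32 x^2)], and the integral of the
    latter. *)
Definition thr_excess_const : R := 4 * (240 * 240 + 1).

Lemma thr_excess_const_ge0 : 0 <= thr_excess_const. Proof. by rewrite /thr_excess_const; lra. Qed.

Lemma gauss_int_thr_excess a s : a = 0 \/ 2 <= a -> 0 <= s <= 1 ->
  exists2 v, gauss_int (fun x => expR (s * thr_excess a x)) v & v <= expR (thr_excess_const * s ^+ 2).
Proof.
move=> a02 /andP[s0 s1].
have a0 : 0 <= a by case: a02 => [->//|]; lra.
have n0 : 0 <= nu a by rewrite (le_trans _ (nu_ge a0))// sqr_ge0.
have iI := gauss_int_ind a; have iS := gauss_int_sqr_ind a0.
have s2 : 0 <= s ^+ 2 by exact: sqr_ge0.
have s24 : 0 <= 4 * s ^+ 2 by lra.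
have c120 : 0 <= 120 * 120 :> R by lra.
have pt x : expR (s * thr_excess a x) + (s * x ^+ 2 + s * nu a * ind a x) <=
   (1 + s) + s * (x ^+ 2 * ind a x) + 4 * s ^+ 2 * (1 + 120 * 120 * expR (15 / 32 * x ^+ 2)).
  have [d1 d2] := thr_excess_sqr x a02.
  have sd1 : s * thr_excess a x <= 1.
    have [d0|d0] := leP 0 (thr_excess a x); last by nra.
    by apply: mulr_ile1.
  have := expR_le_quadratic sd1.
  have x2 := sqr_ge0 x.
  have h4 : (x ^+ 2) ^+ 2 <= 64 * expR (15 / 32 * x ^+ 2).
    have x40 : 0 <= x ^+ 2 / 4 by lra.
    have := sqr_le_expR x40.
    have : expR (x ^+ 2 / 4) <= expR (15 / 32 * x ^+ 2) by rewrite ler_expR; lra.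
    by rewrite expr_div_n; lra.
  have : 4 * s ^+ 2 * thr_excess a x ^+ 2 <= 4 * s ^+ 2 * (1 + 120 * 120 * expR (15 / 32 * x ^+ 2)).
    by rewrite ler_wpM2l//; lra.
  have -> : (s * thr_excess a x) ^+ 2 = s ^+ 2 * thr_excess a x ^+ 2 by rewrite exprMn.
  have -> : s * thr_excess a x = s * (x ^+ 2 * ind a x) - s * nu a * ind a x - s * x ^+ 2 + s.
    by rewrite /thr_excess thrE; ring.
  lra.
have iL := gauss_intD (gauss_intZ s0 gauss_int_sqr) (gauss_intZ (mulr_ge0 s0 n0) iI).
have iR := gauss_intD (gauss_intD (gauss_int_cst (addr_ge0 ler01 s0)) (gauss_intZ s0 iS))
  (gauss_intZ s24 (gauss_intD (gauss_int_cst ler01) (gauss_intZ c120 gauss_int_expR1532))).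
have [v iv] : exists v, gauss_int (fun x => expR (s * thr_excess a x)) v.
  apply: (gauss_int_dom iR).
    by apply: measurableT_comp => //; apply: measurable_funM => //; exact: measurable_thr_excess.
  move=> x; rewrite expR_ge0/=; apply: le_trans (pt x).
  by rewrite lerDl; nonneg.
exists v => //.
have := gauss_int_le (gauss_intD iv iL) iR pt => h.
have := expR_ge1Dx (thr_excess_const * s ^+ 2); rewrite /thr_excess_const; lra.
Qed.

(** For [s >= 0] the exponential is decreasing in [|x|], so a shift only lowers its mean: the bound
    is uniform in the signal [m]. *)
Lemma thr_excess_mgf a s m : a = 0 \/ 2 <= a -> 0 <= s <= 1 ->
  (\int[gam]_z (expR (s * thr_excess a (m + z)))%:E <= (expR (thr_excess_const * s ^+ 2))%:E)%E.
Proof.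
move=> a02 s01; have [v iv vb] := gauss_int_thr_excess a02 s01.
apply: le_trans (_ : v%:E <= _)%E; last by rewrite lee_fin.
apply: (gauss_anderson (F := fun x => expR (s * thr_excess a x))) => // x y xy.
have a0 : 0 <= a by case: a02 => [->//|]; lra.
by rewrite ler_expR ler_wpM2l ?thr_excess_mono//; case/andP: s01.
Qed.

End anderson.

(** * Algebra of the CUSUM contrasts *)

Section cusum_algebra.
Context {R : realType}.
Implicit Types (n v eta t : nat).

Definition cusum_weight n v t : R :=
  if (t <= v)%N then Num.sqrt ((n - v)%:R / (n%:R * v%:R))
  else - Num.sqrt (v%:R / (n%:R * (n - v)%:R)).

Lemma cusumE (y : nat -> R) n v : (0 < v < n)%N ->
  cusum y 0 v n = \sum_(1 <= t < n.+1) cusum_weight n v t * y t.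
Proof.
move=> /andP[v0 vn]; rewrite /cusum !subn0.
rewrite [RHS](@big_cat_nat _ _ _ v.+1)//=; last exact: ltnW.
rewrite !mulr_sumr -sumrN; congr (_ + _).
  by apply: eq_big_nat => t /andP[_ tv]; rewrite /cusum_weight -ltnS tv.
by apply: eq_big_nat => t /andP[tv _]; rewrite /cusum_weight leqNgt tv mulNr.
Qed.

Lemma sum_const_nat a b (x : R) : \sum_(a <= t < b) x = (b - a)%:R * x.
Proof. by rewrite sumr_const_nat mulr_natl. Qed.

Lemma cusum_weight_sqrtP n v : (0 < v < n)%N ->
  let al := Num.sqrt ((n - v)%:R / (n%:R * v%:R)) : R in
  let be := Num.sqrt (v%:R / (n%:R * (n - v)%:R)) : R in
  [/\ al ^+ 2 = (n%:R - v%:R) / (n%:R * v%:R), be ^+ 2 = v%:R / (n%:R * (n%:R - v%:R)) &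
      v%:R * al = (n%:R - v%:R) * be].
Proof.
move=> /andP[v0 vn] al be.
have V0 : 0 < v%:R :> R by rewrite ltr0n.
have N0 : 0 < n%:R :> R by rewrite ltr0n (ltn_trans v0).
have D0 : 0 < n%:R - v%:R :> R by rewrite subr_gt0 ltr_nat.
have nvE : (n - v)%:R = n%:R - v%:R :> R by rewrite natrB// ltnW.
have a2 : al ^+ 2 = (n%:R - v%:R) / (n%:R * v%:R).
  by rewrite sqr_sqrtr nvE// divr_ge0 ?mulr_ge0// ltW.
have b2 : be ^+ 2 = v%:R / (n%:R * (n%:R - v%:R)).
  by rewrite sqr_sqrtr nvE// divr_ge0 ?mulr_ge0// ltW.
split => //; apply/eqP; rewrite -(@eqrXn2 _ 2)// ?mulr_ge0 ?sqrtr_ge0 ?ler0n ?(ltW D0)//.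
by rewrite !exprMn a2 b2; apply/eqP; field; rewrite !gt_eqF.
Qed.

Lemma cusum_weight_sum0 n v : (0 < v < n)%N -> \sum_(1 <= t < n.+1) cusum_weight n v t = 0.
Proof.
move=> vn; have [_ _ e] := cusum_weight_sqrtP vn; have := cusumE (fun=> 1) vn.
under [X in _ = X -> _]eq_bigr do rewrite mulr1.
move=> <-; have /andP[v0 vn'] := vn.
rewrite /cusum !sum_const_nat !subn0 !subSS subn0 !mulr1 natrB ?(ltnW vn')//.
by move: e => /=; rewrite natrB ?(ltnW vn')//; lra.
Qed.

Lemma cusum_weight_sumsq n v : (0 < v < n)%N -> \sum_(1 <= t < n.+1) cusum_weight n v t ^+ 2 = 1.
Proof.
move=> vn; have [a2 b2 _] := cusum_weight_sqrtP vn; have /andP[v0 vn'] := vn.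
have V0 : 0 < v%:R :> R by rewrite ltr0n.
have N0 : 0 < n%:R :> R by rewrite ltr0n (ltn_trans v0).
have D0 : 0 < n%:R - v%:R :> R by rewrite subr_gt0 ltr_nat.
rewrite (@big_cat_nat _ _ _ v.+1)//=; last exact: ltnW.
rewrite (eq_big_nat _ _ (F2 := fun=> (n%:R - v%:R) / (n%:R * v%:R))); last first.
  by move=> t /andP[_ tv]; rewrite /cusum_weight -ltnS tv a2.
rewrite [X in _ + X](eq_big_nat _ _ (F2 := fun=> v%:R / (n%:R * (n%:R - v%:R)))); last first.
  by move=> t /andP[tv _]; rewrite /cusum_weight leqNgt tv /= sqrrN b2.
rewrite !sum_const_nat !subSS subn0 natrB ?(ltnW vn')//.
by field; rewrite !gt_eqF.
Qed.

Definition step eta t : R := (eta < t)%N%:R.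
(** An upward step has a negative CUSUM; the sign makes [psi] nonnegative. *)
Definition psi n eta v : R := - cusum (step eta) 0 v n.

Lemma sum_step a b eta : (a <= b)%N ->
  \sum_(a.+1 <= t < b.+1) step eta t = (b - maxn a eta)%:R.
Proof.
move=> ab; have [ea|ea] := leqP eta a.
  rewrite (eq_big_nat _ _ (F2 := fun=> 1)); last first.
    by move=> t /andP[ta _]; rewrite /step (leq_ltn_trans ea ta).
  by rewrite sum_const_nat mulr1 subSS.
have [be|be] := leqP b eta.
  rewrite (eq_big_nat _ _ (F2 := fun=> 0)); last first.
    by move=> t /andP[_ tb]; rewrite /step ltnNge (leq_trans _ be).
  by rewrite sum_const_nat mulr0 (eqP be).
rewrite (@big_cat_nat _ _ _ eta.+1) /=; [|exact: leqW|by rewrite ltnS ltnW].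
rewrite (eq_big_nat _ _ (F2 := fun=> 0)); last first.
  by move=> t /andP[_ tb]; rewrite /step ltnNge -ltnS tb.
rewrite [X in _ + X](eq_big_nat _ _ (F2 := fun=> 1)); last first.
  by move=> t /andP[ta _]; rewrite /step ta.
by rewrite !sum_const_nat mulr0 add0r mulr1 subSS.
Qed.

Lemma psi_left n eta v : (0 < v < n)%N -> (v <= eta <= n)%N ->
  psi n eta v = (n%:R - eta%:R) * Num.sqrt (v%:R / (n%:R * (n - v)%:R)).
Proof.
move=> /andP[v0 vn] /andP[ve en]; rewrite /psi /cusum !subn0 !sum_step ?(ltnW vn)//.
by rewrite max0n (maxn_idPr ve) (eqP ve) mulr0 sub0r opprK mulrC natrB.
Qed.

Lemma psi_right n eta v : (0 < v < n)%N -> (eta <= v)%N ->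
  psi n eta v = eta%:R * Num.sqrt ((n - v)%:R / (n%:R * v%:R)).
Proof.
move=> vn ev; have [_ _] := cusum_weight_sqrtP vn; have /andP[v0 vn'] := vn.
rewrite /psi /cusum !subn0 !sum_step ?(ltnW vn')//.
rewrite max0n (maxn_idPl ev) !natrB ?(ltnW vn')//.
by set al := Num.sqrt _; set be := Num.sqrt _ => e; rewrite [be * _]mulrC -e; ring.
Qed.

Lemma psi_cusum_weight n eta t : (0 < eta < n)%N ->
  psi n eta eta * cusum_weight n eta t = (n%:R - eta%:R) / n%:R - step eta t.
Proof.
move=> en; have [a2 b2 e] := cusum_weight_sqrtP en; have /andP[e0 en'] := en.
have V0 : 0 < eta%:R :> R by rewrite ltr0n.
have N0 : 0 < n%:R :> R by rewrite ltr0n (ltn_trans e0).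
have D0 : 0 < n%:R - eta%:R :> R by rewrite subr_gt0 ltr_nat.
rewrite psi_right// /cusum_weight /step leqNgt; case: ltnP => _ /=.
  rewrite e mulrN -mulrA -expr2 b2; field; by rewrite !gt_eqF.
by rewrite -mulrA -expr2 a2; field; rewrite !gt_eqF.
Qed.

(* [psi n eta eta * cusum_weight n eta] is minus the centered step at [eta], so its inner product with the
   contrast at [v] is [psi n eta v]. *)
Lemma psi_cross n eta v : (0 < v < n)%N -> (0 < eta < n)%N ->
  \sum_(1 <= t < n.+1) (psi n eta eta * cusum_weight n eta t - psi n eta v * cusum_weight n v t) ^+ 2 =
  psi n eta eta ^+ 2 - psi n eta v ^+ 2.
Proof.
move=> vn en.
have e t : (psi n eta eta * cusum_weight n eta t - psi n eta v * cusum_weight n v t) ^+ 2 =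
    psi n eta eta ^+ 2 * cusum_weight n eta t ^+ 2 + psi n eta v ^+ 2 * cusum_weight n v t ^+ 2 -
    2 * psi n eta v * ((n%:R - eta%:R) / n%:R * cusum_weight n v t) +
    2 * psi n eta v * (cusum_weight n v t * step eta t).
  transitivity (psi n eta eta ^+ 2 * cusum_weight n eta t ^+ 2 + psi n eta v ^+ 2 * cusum_weight n v t ^+ 2 -
    2 * psi n eta v * ((psi n eta eta * cusum_weight n eta t) * cusum_weight n v t)); first by ring.
  by rewrite psi_cusum_weight//; ring.
under eq_bigr do rewrite e.
rewrite !big_split/= sumrN -!mulr_sumr !cusum_weight_sumsq// cusum_weight_sum0// -cusumE//.
by rewrite -[cusum _ _ _ _]opprK -/(psi n eta v); ring.
Qed.

(** [x * y / (x + y)] is at least half of the smaller of [x] and [y]; [harm] also lets [x] be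
    replaced by a smaller [z], so the distance to the nearer end serves on both sides of [eta]. *)
Lemma psi_gap n eta v : (0 < v < n)%N -> (0 < eta < n)%N ->
  Num.min (minn eta (n - eta))%:R `|v%:R - eta%:R| / 2 <= psi n eta eta ^+ 2 - psi n eta v ^+ 2.
Proof.
move=> vn en; have [a2 b2 _] := cusum_weight_sqrtP vn; have [c2 d2 _] := cusum_weight_sqrtP en.
have /andP[v0 vn'] := vn; have /andP[e0 en'] := en.
have V0 : 0 < v%:R :> R by rewrite ltr0n.
have E0 : 0 < eta%:R :> R by rewrite ltr0n.
have N0 : 0 < n%:R :> R by rewrite ltr0n (ltn_trans e0).
have D0 : 0 < n%:R - eta%:R :> R by rewrite subr_gt0 ltr_nat.
have DV : 0 < n%:R - v%:R :> R by rewrite subr_gt0 ltr_nat.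
have m1 : (minn eta (n - eta))%:R <= eta%:R :> R by rewrite ler_nat geq_minl.
have m2 : (minn eta (n - eta))%:R <= n%:R - eta%:R :> R.
  by rewrite -natrB ?(ltnW en')// ler_nat geq_minr.
have harm (x y z : R) : 0 < x -> 0 <= y -> z <= x -> Num.min z y / 2 <= x * y / (x + y).
  move=> x0 y0 zx; rewrite ler_pdivlMr ?ltr_wpDr//.
  have [zy|yz] := leP z y.
    have [z0|z0] := leP 0 z; last by nra.
    have : z * y <= x * y by rewrite ler_wpM2r.
    have : z * x <= x * y by rewrite mulrC ler_wpM2l// ltW.
    lra.
  have : y * x <= x * x by rewrite ler_wpM2r ?(ltW x0)//; lra.
  have : y * y <= x * y by rewrite ler_wpM2r//; lra.
  nra.
have [ve|ev] := leqP v eta.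
  have ve' : v%:R <= eta%:R :> R by rewrite ler_nat.
  rewrite distrC ger0_norm ?subr_ge0//.
  have -> : psi n eta eta ^+ 2 - psi n eta v ^+ 2 =
      (n%:R - eta%:R) * (eta%:R - v%:R) / ((n%:R - eta%:R) + (eta%:R - v%:R)).
    rewrite !psi_left ?ve ?leqnn ?(ltnW en')// !exprMn b2 d2; field.
    by rewrite !gt_eqF//; lra.
  by apply: harm => //; lra.
have ve' : eta%:R <= v%:R :> R by rewrite ler_nat ltnW.
rewrite ger0_norm ?subr_ge0//.
have -> : psi n eta eta ^+ 2 - psi n eta v ^+ 2 =
    eta%:R * (v%:R - eta%:R) / (eta%:R + (v%:R - eta%:R)).
  rewrite !psi_right ?leqnn ?(ltnW ev)// !exprMn a2 c2; field.
  by rewrite !gt_eqF//; lra.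
by apply: harm => //; lra.
Qed.

Lemma cusumD (y z : nat -> R) s v e :
  cusum (fun t => y t + z t) s v e = cusum y s v e + cusum z s v e.
Proof. by rewrite /cusum !big_split/=; ring. Qed.

Lemma cusumZ (y : nat -> R) c s v e : cusum (fun t => y t * c) s v e = cusum y s v e * c.
Proof. by rewrite /cusum -!mulr_suml; ring. Qed.

(** The row is a constant plus its jump times the step, and the contrast annihilates constants.
    Constancy on each side is an induction moving away from [eta]. *)
Lemma cusum_step (y : nat -> R) n eta v : (0 < v < n)%N -> (0 < eta < n)%N ->
  (forall t, (1 <= t < n)%N -> t <> eta -> y t = y t.+1) ->
  cusum y 0 v n = - (y eta.+1 - y eta) * psi n eta v.
Proof.
move=> vn en ye; have /andP[e0 en'] := en.
have yE t : (1 <= t <= n)%N -> y t = y eta + (y eta.+1 - y eta) * step eta t.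
  move=> /andP[t1 tn]; rewrite /step; case: ltnP => te /=; last first.
    rewrite mulr0 addr0; elim: (eta - t)%N {-2}t (erefl (eta - t)%N) t1 te tn => [|k IH] u ku u1 ue un.
      by have -> : u = eta by lia.
    rewrite ye; [|lia|lia]; apply: IH; lia.
  rewrite mulr1 addrCA subrr addr0.
  elim: t t1 tn te => // t IH _ tn te.
  have [->//|et] := eqVneq t eta.
  rewrite -ye; [|lia|by apply/eqP]; apply: IH; lia.
rewrite cusumE// (eq_big_nat _ _ (F2 := fun t => y eta * cusum_weight n v t +
   (y eta.+1 - y eta) * (cusum_weight n v t * step eta t))); last first.
  by move=> t; rewrite ltnS => /yE ->; ring.
rewrite big_split/= -!mulr_sumr cusum_weight_sum0// -cusumE// /psi; ring.
Qed.
End cusum_algebra.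

(** * Tail bounds *)

Section whp.
Context d (Om : measurableType d) (R : realType) (P : probability Om R).

(** A measurable exceptional set is carried along, so [Q] itself may be any predicate and failure
    probabilities simply add. *)
Definition whp (b : R) (Q : Om -> Prop) :=
  exists B, [/\ measurable B, (P B <= b%:E)%E & forall w, ~ B w -> Q w].

Lemma whp_sub b b' (Q Q' : Om -> Prop) : b <= b' -> (forall w, Q w -> Q' w) ->
  whp b Q -> whp b' Q'.
Proof.
move=> bb QQ [B [mB PB h]]; exists B; split => //; last by move=> w /h /QQ.
by apply: (le_trans PB); rewrite lee_fin.
Qed.

Lemma whpT (Q : Om -> Prop) : (forall w, Q w) -> whp 0 Q.
Proof. by move=> h; exists set0; split => //; rewrite measure0. Qed.

Lemma whp_and b b' (Q Q' : Om -> Prop) : whp b Q -> whp b' Q' ->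
  whp (b + b') (fun w => Q w /\ Q' w).
Proof.
move=> [B [mB PB h]] [B' [mB' PB' h']]; exists (B `|` B'); split.
- exact: measurableU.
- rewrite EFinD; apply: le_trans (leeD PB PB'); exact: measureU2.
- by move=> w nB; split; [apply: h|apply: h'] => Bw; apply: nB; [left|right].
Qed.

Lemma whp_all (T : eqType) (s : seq T) (b : T -> R) (Q : T -> Om -> Prop) :
  (forall x, x \in s -> whp (b x) (Q x)) ->
  whp (\sum_(x <- s) b x) (fun w => forall x, x \in s -> Q x w).
Proof.
elim: s => [|x s IH] h; first by rewrite big_nil; exact: whpT.
rewrite big_cons; apply: whp_sub (whp_and (h x (mem_head _ _)) (IH _)) => //.
- by move=> w [h1 h2] y; rewrite inE => /orP[/eqP ->//|]; exact: h2.
- by move=> y ys; apply: h; rewrite inE ys orbT.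
Qed.

Lemma whp_le b (Q : Om -> Prop) : measurable [set w | Q w] -> whp b Q ->
  ((1 - b)%:E <= P [set w | Q w])%E.
Proof.
move=> mQ [B [mB PB h]].
apply: (@le_trans _ _ (P (~` B))).
  rewrite probability_setC// EFinB; exact: leeB.
apply: le_measure; rewrite ?inE//; first exact: measurableC.
Qed.

Lemma whp_chernoff (p : nat) (Z : 'I_p -> Om -> R) (S : pred 'I_p) (G : 'I_p -> R -> R) B x :
  iid_gauss P Z -> 0 <= B -> (forall i, measurable_fun setT (G i)) ->
  (forall i, S i -> (\int[normal_prob 0 1]_z (expR (G i z))%:E <= (expR B)%:E)%E) ->
  whp (expR (#|S|%:R * B - x)) (fun w => \sum_(i | S i) G i (Z i w) < x).
Proof.
move=> iZ B0 mG hG; have [mZ _] := iZ.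
pose F i z := if S i then G i z else 0.
have mF i : measurable_fun setT (F i) by rewrite /F; case: (S i).
have SE w : \sum_(i | S i) G i (Z i w) = \sum_i F i (Z i w) by rewrite big_mkcond.
exists [set w | x <= \sum_i F i (Z i w)]; split.
- have mS : measurable_fun setT (fun w => \sum_i F i (Z i w)).
    by apply: measurable_sum => i; exact: measurableT_comp.
  rewrite [X in measurable X](_ : _ = (fun w => \sum_i F i (Z i w)) @^-1` `[x, +oo[%classic); last first.
    by apply/seteqP; split => w /=; rewrite in_itv/= andbT.
  by rewrite -[X in measurable X]setTI; apply: mS.
- have := @iid_gauss_chernoff _ _ _ P _ Z F (fun i => if S i then B else 0) x iZ mF.
  rewrite -big_mkcond/= sumr_const mulr_natl; apply => i.
  rewrite /F; case: ifPn => Si; first exact: hG.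
  by rewrite expR0 integral_cst//= probability_setT mule1.
- by move=> w /=; rewrite SE => /negP; rewrite -ltNge.
Qed.

End whp.

Section tails.
Context d (Om : measurableType d) (R : realType) (P : probability Om R).
Context (p : nat) (Z : 'I_p -> Om -> R) (iZ : iid_gauss P Z).
Implicit Types (S : pred 'I_p) (K L q h M : R).
Local Notation tc := (@thr_const R).
Local Notation dc := (@thr_excess_const R).
Let tc0 := @thr_const_ge0 R.
Let dc0 := @thr_excess_const_ge0 R.
Local Opaque thr_const thr_excess_const.

(** Large enough for every tail bound below: 480 undoes the restriction on the tilt, [K] becomes the
    exponent of the failure probability, and the other two constants absorb the variance proxies. *)
Definition penalty_const K : R := 480 * (K + tc) + K + dc.

Lemma card_le_p S : #|S|%:R <= p%:R :> R.
Proof. by rewrite ler_nat -[leqRHS](card_ord p) max_card. Qed.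

Lemma thr_whp S a e s B x : a = 0 \/ 2 <= a -> `|e| = 1 -> 0 < s <= 1 / 480 ->
  expR (- (3 / 8) * a ^+ 2) <= B ->
  whp P (expR (p%:R * (tc * s ^+ 2 * B) - s * x))
    (fun w => \sum_(i | S i) e * thr a (Z i w) < x).
Proof.
move=> a02 e1 /andP[s0 s1] hB.
have B0 : 0 <= tc * s ^+ 2 * B.
  have : 0 <= B by apply: le_trans hB; exact: expR_ge0.
  by move=> ?; nonneg.
apply: whp_sub (@whp_chernoff _ _ _ _ _ Z S (fun _ z => (s * e) * thr a z) _ (s * x) iZ B0 _ _).
- by rewrite ler_expR lerD2r ler_wpM2r ?card_le_p.
- move=> w h; rewrite -(ltr_pM2l s0) mulr_sumr; apply: le_lt_trans h.
  by rewrite le_eqVlt; apply/orP; left; apply/eqP; apply: eq_bigr => i _; ring.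
- by move=> _; apply: measurable_funM => //; exact: measurable_thr.
- move=> _ _; apply: (le_trans (thr_mgf a02 _)).
    by rewrite normrM e1 mulr1 gtr0_norm.
  have e2 : e ^+ 2 = 1 by rewrite -(real_normK (num_real e)) e1 expr1n.
  rewrite lee_fin ler_expR exprMn e2 mulr1 ler_wpM2l//.
  by have := sqr_ge0 s; move=> ?; nonneg.
Qed.

Lemma expRN_le_inv (x : R) : 0 < x -> expR (- x) <= x^-1.
Proof.
move=> x0; rewrite expRN lef_pV2 ?posrE ?expR_gt0//.
have := expR_ge1Dx x; lra.
Qed.

(* Chernoff with [s = Num.min 1 (q * L / t ^+ 2) / 480]: the variance proxy is
   [p * (t / q) ^+ 3 = t ^+ 3 / (q * L)]. *)
Lemma sparse_tail S a e K L q h (t : nat) : a = 0 \/ 2 <= a -> `|e| = 1 -> 2 <= K ->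
  1 / 2 <= L -> 0 < q -> q ^+ 2 = p%:R * L -> (1 <= t%:R :> R) && (t%:R <= q) -> t%:R <= h -> L <= h ->
  expR (- (3 / 8) * a ^+ 2) <= (t%:R / q) ^+ 3 ->
  whp P (expR (- (K - 2) * L) * (t%:R^-1 + t%:R / q))
    (fun w => \sum_(i | S i) e * thr a (Z i w) < penalty_const K * h).
Proof.
move=> a02 e1 K2 L2 q0 q2 /andP[t1 tq] th Lh hB.
set T := t%:R in t1 tq th hB *.
have T0 : 0 < T by lra.
have h0 : 0 < h by lra.
have L0 : 0 < L by lra.
have TV0 : 0 < T^-1 by rewrite invr_gt0.
have Tq0 : 0 < T / q by rewrite divr_gt0.
have pE : p%:R * (T / q) ^+ 3 = T ^+ 3 / (q * L).
  have -> : p%:R = q ^+ 2 / L :> R by rewrite q2 mulfK// gt_eqF.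
  by field; rewrite !gt_eqF.
have lamK : 480 * (K + tc) <= penalty_const K by have := dc0; rewrite /penalty_const; lra.
(* With the tilt at its cap the spare exponent [T] gives [exp (- T) <= 1/T]; otherwise it is [q/T],
   giving [T/q]. The two units taken from [K] pay for it, using [L >= 1/2] in the second case. *)
have [tA|tB] := leP (T ^+ 2) (q * L).
  have s1 : 0 < (1 / 480 : R) <= 1 / 480 by apply/andP; split; lra.
  apply: whp_sub (thr_whp S (penalty_const K * h) a02 e1 s1 hB) => //.
  apply: (@le_trans _ _ (expR (- (K - 2) * L) * T^-1)); last first.
    by rewrite ler_wpM2l ?expR_ge0// lerDl ltW.
  apply: (@le_trans _ _ (expR (- (K - 2) * L) * expR (- T))); last first.
    by rewrite ler_wpM2l ?expR_ge0// expRN_le_inv.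
  rewrite -expRD ler_expR.
  have : p%:R * (tc * (1 / 480) ^+ 2 * (T / q) ^+ 3) <=
       tc * (1 / 480) ^+ 2 * T.
    rewrite mulrCA pE ler_wpM2l; [by []|by nonneg|].
    rewrite ler_pdivrMr ?mulr_gt0// exprS ler_wpM2l// ltW//.
  have : 480 * (K + tc) * h <= penalty_const K * h by rewrite ler_wpM2r// ltW.
  have : (K - 2) * L <= (K - 2) * h by rewrite ler_wpM2l//; lra.
  have : tc * T <= tc * h by rewrite ler_wpM2l.
  have : 0 <= tc * T by rewrite mulr_ge0// ltW.
  lra.
have s1 : 0 < 1 / 480 * (q * L / T ^+ 2) <= 1 / 480.
  have : q * L / T ^+ 2 <= 1 by rewrite ler_pdivrMr ?exprn_gt0// mul1r ltW.
  have : 0 < q * L / T ^+ 2 by apply: divr_gt0; [exact: mulr_gt0|exact: exprn_gt0].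
  move=> ? ?; apply/andP; split; lra.
apply: whp_sub (thr_whp S (penalty_const K * h) a02 e1 s1 hB) => //.
apply: (@le_trans _ _ (expR (- (K - 2) * L) * (T / q))); last first.
  by rewrite ler_wpM2l ?expR_ge0// lerDr ltW.
have qT : 1 <= q / T by rewrite ler_pdivlMr// mul1r.
apply: (@le_trans _ _ (expR (- (K - 2) * L) * expR (- (q / T)))); last first.
  by rewrite ler_wpM2l ?expR_ge0// -[T / q]invf_div expRN_le_inv//; lra.
rewrite -expRD ler_expR.
have -> : p%:R * (tc * (1 / 480 * (q * L / T ^+ 2)) ^+ 2 * (T / q) ^+ 3) =
    tc * (1 / 480) ^+ 2 * (L * (q / T)).
  transitivity (tc * (1 / 480 * (q * L / T ^+ 2)) ^+ 2 * (p%:R * (T / q) ^+ 3)).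
    by ring.
  by rewrite pE; field; rewrite !gt_eqF.
have : (K + tc) * (L * (q / T)) <= 1 / 480 * (q * L / T ^+ 2) * (penalty_const K * h).
  apply: (@le_trans _ _ (1 / 480 * (q * L / T ^+ 2) * (480 * (K + tc) * T))).
    by rewrite le_eqVlt; apply/orP; left; apply/eqP; field; rewrite gt_eqF.
  apply: ler_wpM2l; first by case/andP: s1 => /ltW.
  apply: ler_pM; [|exact: ltW T0|exact: lamK|exact: th].
  have := tc0; lra.
have LX : L * 1 <= L * (q / T) by rewrite ler_wpM2l// ltW.
have : 1 / 2 * (q / T) <= L * (q / T) by rewrite ler_wpM2r//; lra.
set X := L * (q / T) in LX *; set Y := q / T in qT *.
have : (K - 2) * L <= (K - 2) * X by rewrite ler_wpM2l//; lra.
have : 0 <= tc * X by rewrite mulr_ge0//; lra.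
lra.
Qed.

(** The tilt that balances the proxy [p s^2] against the linear gain [s h]: both are then comparable
    to [M]. The condition [M <= p] keeps it in the admissible range. *)
Lemma sqrt_scale M h : 0 < M -> M <= p%:R -> Num.sqrt (p%:R * M) <= h ->
  let s := Num.sqrt (M / p%:R) in
  [/\ 0 < s, s <= 1, p%:R * s ^+ 2 = M & M <= s * h].
Proof.
move=> M0 Mp Mh s; have p0 : 0 < p%:R :> R by exact: lt_le_trans Mp.
have Mp0 : 0 < M / p%:R by exact: divr_gt0.
have s0 : 0 < s by rewrite sqrtr_gt0.
have s2 : s ^+ 2 = M / p%:R by rewrite sqr_sqrtr// ltW.
split=> //.
- by rewrite /s -[leRHS]sqrtr1 ler_sqrt ?ler01// ler_pdivrMr// mul1r.
- by rewrite s2; field; rewrite gt_eqF.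
- apply: (@le_trans _ _ (s * Num.sqrt (p%:R * M))); last by rewrite ler_wpM2l// ltW.
  rewrite /s -sqrtrM ?(ltW Mp0)//.
  have -> : M / p%:R * (p%:R * M) = M ^+ 2 by field; rewrite gt_eqF.
  by rewrite sqrtr_sqr ler_norm.
Qed.

Lemma dense_tail S e K M h : `|e| = 1 -> 0 <= K -> 0 < M -> M <= p%:R ->
  Num.sqrt (p%:R * M) <= h ->
  whp P (expR (- K * M)) (fun w => \sum_(i | S i) e * thr 0 (Z i w) < penalty_const K * h).
Proof.
move=> e1 K0 M0 Mp Mh; have [s0 s1 ps sh] := sqrt_scale M0 Mp Mh.
set s := Num.sqrt (M / p%:R) in s0 s1 ps sh.
have lamK : 480 * (K + tc) <= penalty_const K by have := dc0; rewrite /penalty_const; lra.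
have ss : 0 < 1 / 480 * s <= 1 / 480 by apply/andP; split; lra.
have hB : expR (- (3 / 8) * 0 ^+ 2) <= 1 :> R by rewrite expr0n mulr0 expR0.
apply: whp_sub (thr_whp S (penalty_const K * h) (or_introl erefl) e1 ss hB) => //.
rewrite ler_expR.
have -> : p%:R * (tc * (1 / 480 * s) ^+ 2 * 1) =
  tc * (1 / 480) ^+ 2 * M by rewrite -ps; ring.
have -> : 1 / 480 * s * (penalty_const K * h) = 1 / 480 * (penalty_const K * (s * h)) by ring.
have : 480 * (K + tc) * M <= penalty_const K * (s * h).
  by apply: ler_pM; [have := tc0; lra|exact: ltW|exact: lamK|exact: sh].
have : 0 <= tc * M by rewrite mulr_ge0// ltW.
lra.
Qed.

Lemma thr_excess_tail S a K M h (m : 'I_p -> R) : a = 0 \/ 2 <= a -> 0 <= K -> 0 < M -> M <= p%:R ->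
  Num.sqrt (p%:R * M) <= h ->
  whp P (expR (- K * M)) (fun w => \sum_(i | S i) thr_excess a (m i + Z i w) < penalty_const K * h).
Proof.
move=> a02 K0 M0 Mp Mh; have [s0 s1 ps sh] := sqrt_scale M0 Mp Mh.
set s := Num.sqrt (M / p%:R) in s0 s1 ps sh.
have s01 : 0 <= s <= 1 by rewrite (ltW s0).
have B0 : 0 <= dc * s ^+ 2 by have := sqr_ge0 s => ?; nonneg.
apply: whp_sub (@whp_chernoff _ _ _ _ _ Z S (fun i z => s * thr_excess a (m i + z)) _
  (s * (penalty_const K * h)) iZ B0 _ _).
- rewrite ler_expR.
  have : #|S|%:R * (dc * s ^+ 2) <= p%:R * (dc * s ^+ 2).
    by rewrite ler_wpM2r ?card_le_p.
  have -> : p%:R * (dc * s ^+ 2) = dc * M by rewrite -ps; ring.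
  have -> : s * (penalty_const K * h) = penalty_const K * (s * h) by ring.
  have : (K + dc) * M <= penalty_const K * (s * h).
    by apply: ler_pM; [have := dc0; lra|exact: ltW|have := tc0; rewrite /penalty_const; lra|exact: sh].
  lra.
- move=> w hh; rewrite -(ltr_pM2l s0) mulr_sumr; exact: hh.
- move=> i; apply: measurable_funM => //; apply: measurableT_comp; first exact: measurable_thr_excess.
  exact: measurable_funD.
- by move=> i _; exact: thr_excess_mgf.
Qed.

(** Chernoff at tilt [3/8], where the exponential moment per coordinate is 2, below [e]. *)
Lemma chisq_tail S x : whp P (expR (- x)) (fun w => \sum_(i | S i) Z i w ^+ 2 < 8 / 3 * (#|S|%:R + x)).
Proof.
apply: whp_sub (@whp_chernoff _ _ _ _ _ Z S (fun i z => 3 / 8 * z ^+ 2) 1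
  (#|S|%:R + x) iZ ler01 _ _).
- by rewrite ler_expR; lra.
- by move=> w; rewrite -mulr_sumr => h; lra.
- by move=> _; apply: measurable_funM => //; exact: measurable_sqr.
- move=> _ _; have [_ _ ->] := @gauss_int_expR38 R.
  by rewrite lee_fin; have := expR_ge1Dx (1 : R); lra.
Qed.

(** Tilting by [1/4] turns the standard deviation into half the variance plus [4 x], a form the
    signal gap can absorb directly. *)
Lemma linear_tail (c : 'I_p -> R) x :
  whp P (expR (- x)) (fun w => 2 * \sum_i c i * Z i w < (\sum_i c i ^+ 2) / 2 + 4 * x).
Proof.
pose F i z := (c i / 2) * z.
have mF i : measurable_fun setT (F i) by exact: measurable_funM.
have [mZ _] := iZ.
pose X := (\sum_i c i ^+ 2) / 8 + x.
exists [set w | X <= \sum_i F i (Z i w)]; split.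
- have mS : measurable_fun setT (fun w => \sum_i F i (Z i w)).
    by apply: measurable_sum => i; exact: measurableT_comp.
  rewrite [Y in measurable Y](_ : _ = (fun w => \sum_i F i (Z i w)) @^-1` `[X, +oo[%classic); last first.
    by apply/seteqP; split => w /=; rewrite in_itv/= andbT.
  by rewrite -[Y in measurable Y]setTI; apply: mS.
- have := @iid_gauss_chernoff _ _ _ P _ Z F (fun i => c i ^+ 2 / 8) X iZ mF.
  rewrite -mulr_suml /X opprD addrA subrr add0r; apply => i.
  by rewrite /F integral_gauss_expR lee_fin ler_expR expr_div_n; lra.
- move=> w /=; move/negP; rewrite -ltNge /X.
  have -> : \sum_i F i (Z i w) = (\sum_i c i * Z i w) / 2.
    by rewrite mulr_suml; apply: eq_bigr => i _; rewrite /F mulrAC.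
  lra.
Qed.
End tails.

(** * The scale sqrt (p log n), the thresholds and the candidate set *)

Section scales.
Context {R : realType} (p n : nat).
Hypotheses (p1 : (1 <= p)%N) (n2 : (2 <= n)%N).
Local Notation L := (ln n%:R : R).
Local Notation q := (Num.sqrt (plogn R p n)).

Lemma ln_ge_half : 1 / 2 <= L.
Proof.
have e2 : expR (1 / 2) <= 2 :> R.
  have := expR_ge1Dx (- (1 / 2) : R) => h.
  have := expRxMexpNx_1 (1 / 2 : R); have := expR_gt0 (1 / 2 : R).
  set u := expR (1 / 2) in h *; set v := expR (- (1 / 2)) in h * => u0 uv.
  have : u * (1 - 1 / 2) <= u * v by rewrite ler_wpM2l ?(ltW u0).
  rewrite uv; lra.
rewrite -(expRK (1 / 2 : R)) ler_ln ?posrE ?expR_gt0//.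
  by rewrite (le_trans e2)// ler_nat.
by rewrite ltr0n ltnW.
Qed.

Lemma plogn_gt0 : 0 < plogn R p n.
Proof. by rewrite /plogn mulr_gt0 ?ltr0n//; have := ln_ge_half; lra. Qed.

Lemma q_gt0 : 0 < q. Proof. by rewrite sqrtr_gt0 plogn_gt0. Qed.

Lemma q_sqr : q ^+ 2 = p%:R * L.
Proof. by rewrite sqr_sqrtr// ltW// plogn_gt0. Qed.

Lemma ln_ratio (t : nat) : (1 <= t)%N ->
  ln (expR 1 * plogn R p n / t%:R ^+ 2) = 1 + 2 * ln (q / t%:R).
Proof.
move=> t1; have t0 : 0 < t%:R :> R by rewrite ltr0n.
have -> : expR 1 * plogn R p n / t%:R ^+ 2 = expR 1 * (q / t%:R) ^+ 2.
  by rewrite expr_div_n q_sqr /plogn -!mulrA.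
have qt : 0 < q / t%:R by rewrite divr_gt0// q_gt0.
by rewrite lnM ?posrE ?expR_gt0 ?exprn_gt0// expRK lnXn// mulr_natl.
Qed.

Lemma ln_ratio_ge0 (t : nat) : (1 <= t)%N -> t%:R <= q -> 0 <= ln (q / t%:R).
Proof. by move=> t1 tq; rewrite ln_ge0// ler_pdivlMr ?ltr0n// mul1r. Qed.

Lemma a_sqE (t : nat) : (1 <= t)%N -> t%:R <= q -> a_sq R p n t = 4 + 8 * ln (q / t%:R).
Proof. by move=> t1 tq; rewrite /a_sq tq ln_ratio//; ring. Qed.

Lemma a_thr_sqr (t : nat) : (1 <= t)%N -> t%:R <= q ->
  a_thr R p n t ^+ 2 = 4 + 8 * ln (q / t%:R).
Proof.
move=> t1 tq; rewrite /a_thr sqr_sqrtr a_sqE//; have := ln_ratio_ge0 t1 tq; lra.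
Qed.

Lemma a_thr_ge2 (t : nat) : (1 <= t)%N -> t%:R <= q -> 2 <= a_thr R p n t.
Proof.
move=> t1 tq; rewrite -(@ler_sqr R) ?nnegrE ?sqrtr_ge0//.
rewrite a_thr_sqr//; have := ln_ratio_ge0 t1 tq; lra.
Qed.

Lemma a_thr_dense (t : nat) : q < t%:R -> a_thr R p n t = 0.
Proof. by move=> tq; rewrite /a_thr /a_sq leNgt tq /= sqrtr0. Qed.

Lemma a_thr_cases (t : nat) : (1 <= t)%N -> a_thr R p n t = 0 \/ 2 <= a_thr R p n t.
Proof.
move=> t1; have [tq|tq] := leP t%:R q; first by right; exact: a_thr_ge2.
by left; exact: a_thr_dense.
Qed.

(** With [a^2 = 4 + 8 ln (q / t)], the factor [3/8] produces the third power of [t / q]. *)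
Lemma expR_a_thr (t : nat) : (1 <= t)%N -> t%:R <= q ->
  expR (- (3 / 8) * a_thr R p n t ^+ 2) <= (t%:R / q) ^+ 3.
Proof.
move=> t1 tq; have t0 : 0 < t%:R :> R by rewrite ltr0n.
have tq0 : 0 < t%:R / q by rewrite divr_gt0// q_gt0.
rewrite a_thr_sqr// -(lnK (exprn_gt0 3 tq0 : _ \is Num.pos)) ler_expR lnXn//.
rewrite -[q / _]invf_div lnV// mulr_natl; lra.
Qed.

Lemma cand_setP (t : nat) : t \in cand_set R p n ->
  t = p \/ exists2 m, t = (2 ^ m)%N & (2 ^ m)%:R <= q.
Proof.
rewrite inE => /orP[/eqP ->|/mapP[m]]; first by left.
rewrite mem_filter => /andP[h _] ->; right; exists m => //.
by move: h; rewrite /floor_sqrt floor_ge_int.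
Qed.

Lemma pow2_cand (m : nat) : (2 ^ m)%:R <= q -> (2 ^ m)%N \in cand_set R p n.
Proof.
move=> h; rewrite inE; apply/orP; right; apply/mapP; exists m => //.
have h' : ((2 ^ m)%N%:Z <= floor_sqrt R p n)%R by rewrite /floor_sqrt floor_ge_int.
rewrite mem_filter h' andTb mem_iota add0n leq0n andTb ltnS.
have : (m < 2 ^ m)%N by rewrite ltn_expl.
lia.
Qed.

Lemma cand_ge1 (t : nat) : t \in cand_set R p n -> (1 <= t)%N.
Proof. by move=> /cand_setP[->//|[m -> _]]; rewrite expn_gt0. Qed.

(** The weights must be bounded for every cut-off [M], because the list of exponents runs up to the
    floor of [q], a length that may not enter the probability. *)
Lemma cand_whp d (Om : measurableType d) (P : probability Om R) (Q : nat -> Om -> Prop)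
    (b W : R) (w : nat -> R) :
  whp P b (Q p) ->
  (forall m, (2 ^ m)%:R <= q -> whp P (w m) (Q (2 ^ m)%N)) ->
  (forall M, \sum_(m < M | (2 ^ m)%:R <= q) w m <= W) ->
  whp P (b + W) (fun om => forall t, t \in cand_set R p n -> Q t om).
Proof.
move=> hp hm hW.
pose M := `|floor_sqrt R p n|%N.+1.
pose s := [seq m <- index_iota 0 M | (2 ^ m)%:R <= q].
have hs : whp P (\sum_(m <- s) w m) (fun om => forall m, m \in s -> Q (2 ^ m)%N om).
  by apply: whp_all => m; rewrite mem_filter => /andP[h _]; exact: hm.
apply: whp_sub (whp_and hp hs).
  by rewrite lerD2l big_filter big_mkord; exact: hW.
move=> om [h1 h2] t; rewrite inE => /orP[/eqP ->//|/mapP[m]].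
rewrite mem_filter => /andP[h mM] ->; apply: h2.
rewrite mem_filter /index_iota subn0 mM andbT.
by move: h; rewrite /floor_sqrt floor_ge_int.
Qed.

Lemma sum_pow2V M : \sum_(m < M) ((2 ^ m)%:R^-1 : R) <= 2.
Proof.
suff : \sum_(m < M) ((2 ^ m)%:R^-1 : R) <= 2 - 2 * (2 ^ M)%:R^-1.
  by move=> /le_trans; apply; rewrite gerBl mulr_ge0.
elim: M => [|M IH]; first by rewrite big_ord0 expn0 invr1; lra.
rewrite big_ord_recr/= expnS natrM invfM.
set y := (2 ^ M)%:R^-1 in IH *; set x := \sum_(_ < _) _ in IH *; lra.
Qed.

Lemma sum_pow2_le (Q : R) M : 0 < Q -> \sum_(m < M | (2 ^ m)%:R <= Q) ((2 ^ m)%:R : R) <= 2 * Q.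
Proof.
(* The bound by [2 ^ M] is what the induction needs: a new term [2 ^ M <= Q] at most doubles it, and
   the result stays below [2 * Q]. *)
move=> Q0; suff : \sum_(m < M | (2 ^ m)%:R <= Q) ((2 ^ m)%:R : R) <= Num.min (2 * Q) (2 ^ M)%:R.
  by rewrite le_min => /andP[].
elim: M => [|M IH]; first by rewrite big_ord0 le_min mulr_ge0 ?ltW.
rewrite big_mkcond big_ord_recr/= -big_mkcond/=.
move: IH; rewrite !le_min => /andP[h1 h2].
have e : (2 ^ M.+1)%:R = 2 * (2 ^ M)%:R :> R by rewrite expnS natrM.
have p0 : 0 <= (2 ^ M)%:R :> R by [].
rewrite e; case: ifPn => h; last by rewrite addr0; apply/andP; split; lra.
by apply/andP; split; lra.
Qed.

Lemma sum_weights (r : R) M : 0 <= r ->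
  \sum_(m < M | (2 ^ m)%:R <= q) r * ((2 ^ m)%:R^-1 + (2 ^ m)%:R / q) <= 4 * r.
Proof.
move=> r0; rewrite -mulr_sumr mulrC ler_wpM2r// big_split/= -mulr_suml.
have h1 : \sum_(m < M | (2 ^ m)%:R <= q) ((2 ^ m)%:R^-1 : R) <= 2.
  apply: le_trans (sum_pow2V M); rewrite big_mkcond; apply: ler_sum => m _.
  by case: ifP.
have h2 : (\sum_(m < M | (2 ^ m)%:R <= q) ((2 ^ m)%:R : R)) / q <= 2.
  by rewrite ler_pdivrMr ?q_gt0// sum_pow2_le// q_gt0.
lra.
Qed.

(** Weights for the dense case, where the tail gains only the power [ln (e p) ^- 2], hence a
    quadratic decay in the exponent [m] of the candidate. *)
Lemma sum_telescope (r : R) M (S : pred nat) : 0 <= r ->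
  \sum_(m < M | S m) r * (4 / (m.+1%:R * m.+2%:R)) <= 4 * r.
Proof.
move=> r0; rewrite -mulr_sumr mulrC ler_wpM2r//.
suff : \sum_(m < M) (4 / (m.+1%:R * m.+2%:R) : R) <= 4 - 4 / M.+1%:R.
  move=> h; apply: (@le_trans _ _ (\sum_(m < M) (4 / (m.+1%:R * m.+2%:R) : R))).
    by rewrite big_mkcond; apply: ler_sum => m _; case: ifP => // _; rewrite divr_ge0 ?mulr_ge0.
  by apply: (le_trans h); rewrite gerBl divr_ge0.
elim: M => [|M IH]; first by rewrite big_ord0 divr1 subrr.
rewrite big_ord_recr/=; apply: le_trans (lerD IH (lexx _)) _.
rewrite le_eqVlt; apply/orP; left; apply/eqP.
have a0 : M.+1%:R != 0 :> R by rewrite pnatr_eq0.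
have -> : M.+2%:R = M.+1%:R + 1 :> R by rewrite -natr1.
have b0 : M.+1%:R + 1 != 0 :> R by rewrite natr1 pnatr_eq0.
by move: (M.+1%:R : R) a0 b0 => x a0 b0; field; rewrite a0 b0.
Qed.

End scales.

(** * Bounds on the scores *)

Section bounds.
Context {R : realType} (p n : nat).
Hypotheses (p1 : (1 <= p)%N) (n2 : (2 <= n)%N).
Local Notation L := (ln n%:R : R).
Local Notation q := (Num.sqrt (plogn R p n)).
Local Notation M := (Num.max L (ln (ln (expR 1 * p%:R))) : R).
Local Notation a_ t := (a_thr R p n t).

Let L2 : 1 / 2 <= L := ln_ge_half n2.
Let q0 : 0 < q := q_gt0 p1 n2.
Let qq : q ^+ 2 = p%:R * L := q_sqr p1 n2.
Let p0 : 0 < p%:R :> R. Proof. by rewrite ltr0n. Qed.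

Lemma q_lt_p : (q < p%:R) = (L < p%:R).
Proof.
rewrite -(@ltr_sqr R) ?nnegrE ?(ltW q0) ?(ltW p0)//.
by rewrite qq expr2 ltr_pM2l.
Qed.

Lemma L_le_q : L <= p%:R -> L <= q.
Proof.
move=> Lp; rewrite -(@ler_sqr R) ?nnegrE ?(ltW q0)//; last by have := L2; lra.
by rewrite qq expr2 ler_wpM2r//; have := L2; lra.
Qed.

Lemma r_fun_ge (t : nat) : (1 <= t)%N -> t%:R <= q -> L <= p%:R ->
  t%:R <= r_fun R p n t /\ L <= r_fun R p n t.
Proof.
move=> t1 tq Lp; rewrite /r_fun; case: ifPn => _; first by split=> //; exact: L_le_q.
rewrite ln_ratio// !le_max; split; last by rewrite lexx orbT.
apply/orP; left; have := ln_ratio_ge0 t1 tq => h; rewrite ler_peMr ?ler0n//; lra.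
Qed.

(** At [k = q] exactly, [h_fun] takes its dense branch while the threshold is still the sparse one;
    the logarithm vanishes there and the sparse bounds survive. *)
Lemma h_sparse (k : nat) : (1 <= k)%N -> (k <= p)%N -> k%:R <= q ->
  L <= h_fun R p n k /\ k%:R * (1 + 2 * ln (q / k%:R)) <= h_fun R p n k.
Proof.
move=> k1 kp kq; have k0 : 0 < k%:R :> R by rewrite ltr0n.
rewrite /h_fun; case: ifPn => qk; last first.
  by rewrite ln_ratio// !le_max !lexx orbT.
have qkE : q = k%:R by apply/eqP; rewrite eq_le qk kq.
have qh : q <= Num.sqrt (p%:R * M).
  rewrite /plogn ler_sqrt; first by rewrite ler_wpM2l ?ler0n// le_max lexx.
  by rewrite mulr_ge0 ?ler0n// le_max; apply/orP; left; have := L2; lra.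
rewrite qkE divff ?gt_eqF// ln1 mulr0 addr0 mulr1 -qkE; split=> //.
apply: le_trans qh; apply: L_le_q.
have : q * q <= p%:R * q by rewrite ler_wpM2r ?(ltW q0)// qkE ler_nat.
by rewrite -expr2 qq ler_pM2l// => /le_trans; apply; rewrite qkE ler_nat.
Qed.

Lemma ln_le_sub (x : R) : 0 < x -> ln x <= x - 1.
Proof. by move=> x0; have := expR_ge1Dx (ln x); rewrite lnK ?posrE//; lra. Qed.

Lemma ln_ep : ln (expR 1 * p%:R) = 1 + ln p%:R :> R.
Proof. by rewrite lnM ?posrE ?expR_gt0// expRK. Qed.

Lemma lnp_ge0 : 0 <= ln p%:R :> R.
Proof. by rewrite ln_ge0// ler1n. Qed.

Lemma M_le_p : L <= p%:R -> M <= p%:R.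
Proof.
move=> Lp; rewrite ge_max Lp /= ln_ep.
have l0 := lnp_ge0; have := ln_le_sub p0.
have l1 : 0 < 1 + ln p%:R :> R by lra.
have := ln_le_sub l1; lra.
Qed.

Lemma h_dense (k : nat) : q < k%:R -> (k <= p)%N ->
  [/\ h_fun R p n k = Num.sqrt (p%:R * M), L < p%:R, M <= p%:R & q <= h_fun R p n k].
Proof.
move=> qk kp; have Lp : L < p%:R.
  by rewrite -q_lt_p (lt_le_trans qk)// ler_nat.
rewrite /h_fun (ltW qk); split => //; first exact: M_le_p (ltW Lp).
rewrite /plogn ler_sqrt; first by rewrite ler_wpM2l ?ler0n// le_max lexx.
by rewrite mulr_ge0 ?ler0n// le_max; apply/orP; left; have := L2; lra.
Qed.

Lemma nu_a_ge0 (t : nat) : (1 <= t)%N -> 0 <= nu (a_ t).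
Proof.
move=> t1; have a0 : 0 <= a_ t by exact: sqrtr_ge0.
by apply: le_trans (nu_ge a0); exact: sqr_ge0.
Qed.

Section deterministic.
Variables (th Z : 'I_p -> R) (ps : R).
Local Notation C i := (- th i * ps + Z i).
(** The [A_v] of the overview, with [ps] for [psi_v]. It equals the sum of [C i ^+ 2 - Z i ^+ 2],
    which vanishes off the support. *)
Definition signal_part : R := \sum_i (th i ^+ 2 * ps ^+ 2 - 2 * ps * (th i * Z i)).

Lemma signal_partE : signal_part = \sum_(i | th i != 0) (C i ^+ 2 - Z i ^+ 2).
Proof.
rewrite /signal_part [RHS]big_mkcond; apply: eq_bigr => i _.
by case: ifPn => [_|/negbNE/eqP ->]; ring.
Qed.

Lemma signal_partEall : signal_part = \sum_i (C i ^+ 2 - Z i ^+ 2).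
Proof. by apply: eq_bigr => i _; ring. Qed.

Lemma thr_le_sqr (a x : R) : 0 <= nu a -> thr a x <= x ^+ 2.
Proof. by move=> n0; rewrite /thr; case: ifP => _; [lra|exact: sqr_ge0]. Qed.

Lemma thr_ge (a x : R) : 0 <= a -> x ^+ 2 - (a ^+ 2 + nu a) <= thr a x.
Proof.
move=> a0; have n0 := nu_ge a0; have a2 := sqr_ge0 a; rewrite /thr; case: (leP a `|x|) => h; first lra.
have : x ^+ 2 <= a ^+ 2 by rewrite -(real_normK (num_real x)) ler_sqr ?nnegrE// ltW.
lra.
Qed.

Lemma sum_thr_split (a : R) : \sum_i thr a (C i) =
  \sum_(i | th i != 0) thr a (C i) + \sum_(i | th i == 0) thr a (Z i).
Proof.
rewrite (bigID (fun i => th i != 0))/=; congr (_ + _).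
by apply: eq_big => [i|i]; rewrite negbK// => /eqP ->; rewrite oppr0 mul0r add0r.
Qed.

Lemma upper_all (a Y : R) : 0 <= nu a -> \sum_i Z i ^+ 2 < Y ->
  \sum_i thr a (C i) <= signal_part + Y.
Proof.
move=> n0 hY; rewrite signal_partEall sumrB.
have : \sum_i thr a (C i) <= \sum_i C i ^+ 2 by apply: ler_sum => i _; exact: thr_le_sqr.
lra.
Qed.

Lemma upper_sparse (a X Y : R) : 0 <= nu a ->
  \sum_(i | th i == 0) thr a (Z i) < X -> \sum_(i | th i != 0) Z i ^+ 2 < Y ->
  \sum_i thr a (C i) <= signal_part + X + Y.
Proof.
move=> n0 hX hY; rewrite sum_thr_split signal_partE sumrB.
have : \sum_(i | th i != 0) thr a (C i) <= \sum_(i | th i != 0) C i ^+ 2.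
  by apply: ler_sum => i _; exact: thr_le_sqr.
lra.
Qed.

Lemma thr0E (x : R) : thr 0 x = x ^+ 2 - 1.
Proof. by rewrite /thr normr_ge0 nu0. Qed.

(** On the support, [thr a (C i)] is its excess over [C i ^+ 2 - 1], plus the centered square of the
    noise, plus the signal term. No bound proportional to [k] appears. *)
Lemma upper_dense (a X Y : R) :
  \sum_(i | th i == 0) thr a (Z i) < X -> \sum_(i | th i != 0) thr_excess a (C i) < Y ->
  \sum_(i | th i != 0) thr 0 (Z i) < Y ->
  \sum_i thr a (C i) <= signal_part + X + 2 * Y.
Proof.
move=> hX hY hZ; rewrite sum_thr_split signal_partE.
have -> : \sum_(i | th i != 0) thr a (C i) = \sum_(i | th i != 0) thr_excess a (C i) +
    (\sum_(i | th i != 0) thr 0 (Z i) + \sum_(i | th i != 0) (C i ^+ 2 - Z i ^+ 2)).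
  by rewrite -!big_split/=; apply: eq_bigr => i _; rewrite /thr_excess thr0E; ring.
lra.
Qed.

(** Thresholding costs a support coordinate at most [a^2 + nu a]; with [t] close to [k], [k] times
    this is [O(h)]. *)
Lemma lower_sparse (a X : R) : 0 <= a ->
  \sum_(i | th i == 0) -1 * thr a (Z i) < X ->
  signal_part - X - #|[pred i | th i != 0]|%:R * (a ^+ 2 + nu a) <= \sum_i thr a (C i).
Proof.
move=> a0; rewrite -mulr_sumr sum_thr_split signal_partE sumrB => hX.
have : \sum_(i | th i != 0) (C i ^+ 2 - (a ^+ 2 + nu a)) <= \sum_(i | th i != 0) thr a (C i).
  by apply: ler_sum => i _; exact: thr_ge.
rewrite sumrB sumr_const mulr_natl => h.
have : 0 <= \sum_(i | th i != 0) Z i ^+ 2 by apply: sumr_ge0 => i _; exact: sqr_ge0.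
lra.
Qed.

Lemma lower_dense (X : R) : \sum_i -1 * thr 0 (Z i) < X ->
  signal_part - X <= \sum_i thr 0 (C i).
Proof.
rewrite -mulr_sumr => hX.
have -> : \sum_i thr 0 (C i) = signal_part + \sum_i thr 0 (Z i).
  by rewrite signal_partEall -big_split/=; apply: eq_bigr => i _; rewrite !thr0E; ring.
lra.
Qed.
End deterministic.

Section probabilistic.
Context d (Om : measurableType d) (P : probability Om R).
Context (Z : 'I_p -> Om -> R) (iZ : iid_gauss P Z) (K : R).
Hypothesis K2 : 2 <= K.
Local Notation rho := (expR (- (K - 2) * L)).
Variables (th : 'I_p -> R).
Local Notation k := #|[pred i : 'I_p | th i != 0]|.
Hypothesis k1 : (1 <= k)%N.
Local Notation h := (h_fun R p n k).
Local Notation lam := (penalty_const K).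

Lemma penalty_const_ge0 : 0 <= lam.
Proof.
have K2' := K2.
have := @thr_const_ge0 R; have := @thr_excess_const_ge0 R; rewrite /penalty_const.
move: (@thr_const R) (@thr_excess_const R) => x y x0 y0; lra.
Qed.

Let kp : (k <= p)%N. Proof. by rewrite -[leqRHS](card_ord p) max_card. Qed.

Lemma expR_rho (x : R) : L <= x -> expR (- K * x) <= rho.
Proof.
have K2' := K2. by move=> Lx; rewrite ler_expR; have := L2; nra. Qed.

(** Each candidate is held to its own penalty [r(t)], since the failure probabilities are summable.
    [L < p] means [q < p], so the candidate [p] has threshold 0. *)
Lemma noise_tail (S : pred 'I_p) : L < p%:R ->
  whp P (rho + 4 * rho) (fun w => forall t, t \in cand_set R p n ->
    \sum_(i | S i) thr (a_ t) (Z i w) < lam * r_fun R p n t).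
Proof.
have K2' := K2.
move=> Lp; apply: (cand_whp (w := fun m => rho * ((2 ^ m)%:R^-1 + (2 ^ m)%:R / q))).
- have qp : q < p%:R by rewrite q_lt_p.
  rewrite a_thr_dense// /r_fun (ltW qp).
  have L0 : 0 < L by have := L2; lra.
  have K0 : 0 <= K by lra.
  apply: whp_sub (@dense_tail _ _ _ P _ _ iZ S 1 K L q (normr1 _) K0 L0 (ltW Lp) (lexx _)).
    exact: expR_rho.
  by move=> w; under eq_bigr do rewrite mul1r.
- move=> m mq; have t1 : (1 <= 2 ^ m)%N by rewrite expn_gt0.
  have [tr Lr] := r_fun_ge t1 mq (ltW Lp).
  have t1q : (1 <= (2 ^ m)%:R :> R) && ((2 ^ m)%:R <= q) by rewrite ler1n t1 mq.
  apply: whp_sub (@sparse_tail _ _ _ P _ _ iZ S (a_ (2 ^ m)%N) 1 K L q _ (2 ^ m)%N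
    (a_thr_cases p1 n2 t1) (normr1 _) K2 L2 q0 qq t1q tr Lr (expR_a_thr p1 n2 t1 mq)) => //.
  by move=> w; under eq_bigr do rewrite mul1r.
- by move=> M'; apply: sum_weights => //; exact: expR_ge0.
Qed.

(** Every candidate has the same bound [exp (- K M)], and the part of [M] above [log log (ep)] pays
    for the union. As [2^j <= p], the index [j] is at most of order [ln (e p)], so [ln (e p) ^- 2]
    is below the telescoping weight. *)
Lemma thr_excess_noise_tail (S : pred 'I_p) (m : 'I_p -> R) : L < p%:R -> Num.sqrt (p%:R * M) <= h ->
  whp P (rho + 4 * rho) (fun w => forall t, t \in cand_set R p n ->
    \sum_(i | S i) thr_excess (a_ t) (m i + Z i w) < lam * h).
Proof.
have K2' := K2.
move=> Lp Mh; have LM : L <= M by rewrite le_max lexx.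
have M0 : 0 < M by have := L2; lra.
have Mp := M_le_p (ltW Lp).
have K0 : 0 <= K by lra.
have hd t : (1 <= t)%N -> whp P (expR (- K * M))
   (fun w => \sum_(i | S i) thr_excess (a_ t) (m i + Z i w) < lam * h).
  by move=> t1; apply: thr_excess_tail => //; exact: a_thr_cases.
apply: (cand_whp (w := fun j => rho * (4 / (j.+1%:R * j.+2%:R)))).
- by apply: whp_sub (hd p p1) => //; exact: expR_rho.
- move=> j jq; apply: whp_sub (hd (2 ^ j)%N _) => //; last by rewrite expn_gt0.
  have lM : ln (ln (expR 1 * p%:R)) <= M by rewrite le_max lexx orbT.
  set l := ln (ln _) in lM.
  (* [K M] is split into [(K - 2) L], which gives [rho], and [2 l], which gives the weight of the
     candidate. *)
  apply: (@le_trans _ _ (rho * expR (- (2 * l)))).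
    rewrite -expRD ler_expR; nra.
  rewrite ler_wpM2l ?expR_ge0//.
  have lp1 : 0 < ln (expR 1 * p%:R) :> R by rewrite ln_ep; have := lnp_ge0; lra.
  have -> : expR (- (2 * l)) = (ln (expR 1 * p%:R) ^+ 2)^-1.
    by rewrite expRN mulr_natl mulr2n expRD lnK ?posrE.
  have jl : (j%:R + 2) / 2 <= ln (expR 1 * p%:R) :> R.
    rewrite ln_ep; have : ln (2 ^ j)%:R <= ln p%:R :> R.
      rewrite ler_ln ?posrE ?ltr0n ?expn_gt0//.
      by apply: (le_trans jq); apply: ltW; rewrite q_lt_p.
    rewrite natrX lnXn// -[_ *+ j]mulr_natl => hj.
    have : j%:R * (1 / 2) <= j%:R * ln 2 :> R.
      by rewrite ler_wpM2l//; exact: (@ln_ge_half R 2).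
    lra.
  rewrite -[leRHS]invf_div lef_pV2 ?posrE ?divr_gt0 ?mulr_gt0 ?ltr0n ?exprn_gt0//.
  rewrite -!(natr1 j) -[j.+2%:R]natr1 -(natr1 j).
  have j0 : 0 <= j%:R :> R by [].
  have : ((j%:R + 2) / 2) ^+ 2 <= ln (expR 1 * p%:R) ^+ 2 :> R.
    by rewrite ler_sqr ?nnegrE ?(ltW lp1)//; lra.
  rewrite !expr2; nra.
- by move=> M'; apply: (sum_telescope M' (fun m => (2 ^ m)%:R <= q)); exact: expR_ge0.
Qed.

(** [8/3 (1 + K)] covers chi-square sums. Of the [4 lam], one is for the noise and three for the
    penalty at a sparsity within a factor 2 of [k]. [192 = 16 * 4 * 3] is the thresholding loss:
    [a^2 + nu a <= 16 a^2], then the 4 in [a^2] and the factor 3 between [t] and [k]. *)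
Definition slack : R := 8 / 3 * (1 + K) + 4 * lam + 192.

Lemma r_fun_ge0 (t : nat) : 0 <= r_fun R p n t.
Proof.
rewrite /r_fun; case: ifP => _; first exact: sqrtr_ge0.
by rewrite le_max; apply/orP; right; have := L2; lra.
Qed.

Lemma h_ge_L : L <= h.
Proof.
have [kq|qk] := leP k%:R q; first by have [] := h_sparse k1 kp kq.
have [_ Lp _ qh] := h_dense qk kp.
by apply: le_trans qh; exact: L_le_q (ltW Lp).
Qed.

(** For [k <= q] the squares of the noise on the support may be bounded crudely, because [k <= h].
    For larger [k] they must be compared with their mean, which is the task of [thr_excess]. *)
Lemma score_upper (ps : R) :
  whp P (12 * rho) (fun w => forall t, t \in cand_set R p n ->
    \sum_i thr (a_ t) (- th i * ps + Z i w) - lam * r_fun R p n t <=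
    signal_part th (Z^~ w) ps + slack * h).
Proof.
have K2' := K2.
have l0 := penalty_const_ge0; have r0 := expR_ge0 (- (K - 2) * L).
have hL := h_ge_L; have h0 : 0 <= h by have := L2; lra.
have lh : 0 <= lam * h by rewrite mulr_ge0.
have KL : K * L <= K * h by rewrite ler_wpM2l//; lra.
have nr t : 0 <= lam * r_fun R p n t by rewrite mulr_ge0// r_fun_ge0.
have eK : expR (- (K * L)) <= rho by rewrite -mulNr expR_rho.
(* When [p <= ln n] the penalty can be as small as [q < ln n] at [t = q], but then the whole noise
   energy is already [O(ln n)]. *)
have [pL|Lp] := leP p%:R L.
  apply: whp_sub (chisq_tail iZ predT (K * L)) => [|w hw t tc]; first by lra.
  have := upper_all th ps (nu_a_ge0 (cand_ge1 p1 tc)) hw.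
  rewrite card_ord => hu; have := nr t.
  rewrite /slack; lra.
have [kq|qk] := leP k%:R q.
  have [_ kh] := h_sparse k1 kp kq.
  have kh' : k%:R <= h.
    apply: le_trans kh; rewrite ler_peMr//; have := ln_ratio_ge0 k1 kq; lra.
  apply: whp_sub (whp_and (noise_tail (fun i => th i == 0) Lp)
    (chisq_tail iZ (fun i => th i != 0) (K * L))) => [|w [h1 h2] t tc]; first by lra.
  have := upper_sparse ps (nu_a_ge0 (cand_ge1 p1 tc)) (h1 t tc) h2.
  rewrite /slack; lra.
have [hE _ Mp qh] := h_dense qk kp.
have Mh : Num.sqrt (p%:R * M) <= h by rewrite hE.
have LM : L <= M by rewrite le_max lexx.
have M0 : 0 < M by have := L2; lra.
have K0 : 0 <= K by lra.
apply: whp_sub (whp_and (noise_tail (fun i => th i == 0) Lp)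
   (whp_and (thr_excess_noise_tail (fun i => th i != 0) (fun i => - th i * ps) Lp Mh)
   (@dense_tail _ _ _ P _ _ iZ (fun i => th i != 0) 1 K M h (normr1 _) K0 M0 Mp Mh))).
  by have := expR_rho LM; lra.
move=> w [h1 [h2 h3]] t tc.
have h3' : \sum_(i | th i != 0) thr 0 (Z i w) < lam * h.
  by move: h3; under eq_bigr do rewrite mul1r.
have := upper_dense (h1 t tc) (h2 t tc) h3'.
have : 0 <= 8 / 3 * (1 + K) * h by rewrite mulr_ge0//; lra.
rewrite /slack; lra.
Qed.

Lemma score_lower (ps : R) :
  whp P (2 * rho) (fun w => exists2 t, t \in cand_set R p n &
    signal_part th (Z^~ w) ps - slack * h <=
    \sum_i thr (a_ t) (- th i * ps + Z i w) - lam * r_fun R p n t).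
Proof.
have K2' := K2.
have l0 := penalty_const_ge0; have r0 := expR_ge0 (- (K - 2) * L).
have hL := h_ge_L; have h0 : 0 <= h by have := L2; lra.
have lh : 0 <= lam * h by rewrite mulr_ge0.
have Kh : 0 <= 8 / 3 * (1 + K) * h by rewrite mulr_ge0//; lra.
have e1 : `|-1| = 1 :> R by rewrite normrN1.
have [kq|qk] := leP k%:R q; last first.
  have [hE Lp Mp qh] := h_dense qk kp.
  have Mh : Num.sqrt (p%:R * M) <= h by rewrite hE.
  have LM : L <= M by rewrite le_max lexx.
  have M0 : 0 < M by have := L2; lra.
  have K0 : 0 <= K by lra.
  have qp : q < p%:R by rewrite q_lt_p.
  apply: whp_sub (@dense_tail _ _ _ P _ _ iZ predT (-1) K M h e1 K0 M0 Mp Mh).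
    by have := expR_rho LM; lra.
  move=> w hw; exists p; first by rewrite inE eqxx.
  rewrite a_thr_dense// /r_fun (ltW qp).
  have := lower_dense th ps hw.
  have : lam * q <= lam * h by rewrite ler_wpM2l.
  rewrite /slack; lra.
have [_ kh] := h_sparse k1 kp kq.
have lk := ln_ratio_ge0 k1 kq.
have k0 : 0 < k%:R :> R by rewrite ltr0n.
have kh' : k%:R <= h by apply: le_trans kh; rewrite ler_peMr//; lra.
pose m := trunc_log 2 k; pose t := (2 ^ m)%N.
have tk : (t <= k)%N by exact: trunc_logP.
have kt : (k < 2 * t)%N by rewrite /t -expnS; exact: trunc_log_ltn.
have t1 : (1 <= t)%N by rewrite expn_gt0.
have t0 : 0 < t%:R :> R by rewrite ltr0n.
have tkR : t%:R <= k%:R :> R by rewrite ler_nat.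
have ktR : k%:R <= 2 * t%:R :> R by rewrite -natrM ler_nat ltnW.
have tq : t%:R <= q by exact: le_trans kq.
have th' : t%:R <= h by exact: le_trans kh'.
have t1q : (1 <= t%:R :> R) && (t%:R <= q) by rewrite ler1n t1 tq.
(* Halving [k] adds at most [ln 2 <= 1] to the logarithm, and [1 + 2 (1 + x) <= 3 (1 + 2 x)] for
   [x >= 0]. *)
have lt : 1 + 2 * ln (q / t%:R) <= 3 * (1 + 2 * ln (q / k%:R)).
  have qk0 : 0 < q / k%:R by rewrite divr_gt0.
  have qk20 : 0 < 2 * (q / k%:R) by rewrite mulr_gt0.
  have qt0 : 0 < q / t%:R by rewrite divr_gt0.
  have : ln (q / t%:R) <= ln (2 * (q / k%:R)).
    rewrite ler_ln ?posrE// ler_pdivrMr//.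
    have -> : 2 * (q / k%:R) * t%:R = q * (2 * t%:R) / k%:R by ring.
    by rewrite ler_pdivlMr// ler_wpM2l// ltW.
  rewrite [ln (2 * _)]lnM ?posrE// => hl.
  have : ln 2 <= 1 :> R by have := @ln_le_sub 2 ltac:(lra); lra.
  lra.
have lt0 := ln_ratio_ge0 t1 tq.
apply: whp_sub (@sparse_tail _ _ _ P _ _ iZ (fun i => th i == 0) (a_ t) (-1) K L q h t
    (a_thr_cases p1 n2 t1) e1 K2 L2 q0 qq t1q th' hL (expR_a_thr p1 n2 t1 tq)).
  rewrite mulrC ler_wpM2r//.
  have : t%:R^-1 <= 1 :> R by rewrite invf_le1// ler1n.
  have : t%:R / q <= 1 by rewrite ler_pdivrMr// mul1r.
  lra.
move=> w hw; exists t; first exact: pow2_cand.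
have a0 : 0 <= a_ t by exact: sqrtr_ge0.
have := lower_sparse ps a0 hw.
have rt : r_fun R p n t <= 3 * h.
  rewrite /r_fun; case: ifPn => qt.
    by apply: (le_trans qt); lra.
  rewrite ge_max ln_ratio//; apply/andP; split; last by lra.
  apply: (@le_trans _ _ (k%:R * (3 * (1 + 2 * ln (q / k%:R))))); last by lra.
  by apply: ler_pM => //; lra.
have ka : k%:R * (a_ t ^+ 2 + nu (a_ t)) <= 192 * h.
  apply: (@le_trans _ _ (k%:R * (16 * (4 * (3 * (1 + 2 * ln (q / k%:R))))))); last by lra.
  rewrite ler_wpM2l//.
  have := nu_le (a_thr_ge2 p1 n2 t1 tq).
  by rewrite (a_thr_sqr p1 n2 t1 tq); lra.
have : lam * r_fun R p n t <= lam * (3 * h) by rewrite ler_wpM2l.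
rewrite /slack; lra.
Qed.

End probabilistic.
End bounds.

(** * Localization of the maximiser *)

Section argmax.
Context {R : realType}.
Implicit Types (f : nat -> R) (n v : nat).

Lemma smallest_argmaxP n f u : (0 < u < n)%N ->
  (0 < smallest_argmax n f < n)%N /\ f u <= f (smallest_argmax n f).
Proof.
move=> /andP[u0 un]; rewrite /smallest_argmax.
set M := \big[Num.max/f 1%N]_(1 <= v < n) f v; set s := iota 1 n.-1.
have s1 v : (v \in s) = (0 < v < n)%N.
  by rewrite mem_iota add1n prednK// (ltn_trans u0).
have uM : f u <= M by rewrite /M; apply: le_bigmax_seq => //; rewrite mem_index_iota u0.
have hM : has (fun v => f v == M) s.
  have [v vs ->] : exists2 v, v \in s & M = f v.
    rewrite /M /index_iota subn1 -/s.
    have h1 : 1%N \in s by rewrite s1 (leq_ltn_trans u0 un).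
    suff H r : {subset r <= s} -> exists2 v, v \in s & \big[Num.max/f 1%N]_(v <- r) f v = f v.
      exact: H.
    elim: r => [_|x r IH xr]; first by rewrite big_nil; exists 1%N.
    rewrite big_cons; have [|v vs ->] := IH; first by move=> v vr; apply: xr; rewrite inE vr orbT.
    rewrite /Num.max; case: ifP => _; first by exists v.
    by exists x => //; apply: xr; rewrite mem_head.
  by apply/hasP; exists v.
have := nth_find 0%N hM => /eqP ->; split => //.
by rewrite -s1 mem_nth// -has_find.
Qed.

Lemma score_ge p n (Y : 'I_p -> nat -> R) g s v e t : t \in cand_set R p n ->
  score_t n Y g s v e t <= score n Y g s v e.
Proof. by move=> tc; rewrite /score; apply: le_bigmax_seq. Qed.

Lemma score_le p n (Y : 'I_p -> nat -> R) g s v e B :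
  (forall t, t \in cand_set R p n -> score_t n Y g s v e t <= B) -> score n Y g s v e <= B.
Proof.
move=> h; rewrite /score big_seq; apply: bigmax_le => [|t tc]; last exact: h.
by apply: h; rewrite inE eqxx.
Qed.

Lemma score_tE p n (Y : 'I_p -> nat -> R) g s v e t :
  score_t n Y g s v e t = \sum_i thr (a_thr R p n t) (cusum (Y i) s v e) - g t.
Proof. by []. Qed.
End argmax.

(** * Measurability of the estimator *)

Section measurability.
Context d (Om : measurableType d) (R : realType).

Lemma measurable_bigmax (T : Type) (s : seq T) (x : Om -> R) (f : T -> Om -> R) :
  measurable_fun setT x -> (forall t, measurable_fun setT (f t)) ->
  measurable_fun setT (fun w => \big[Num.max/x w]_(t <- s) f t w).
Proof.
move=> mx mf; elim: s => [|t s IH]; first by under eq_fun do rewrite big_nil.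
by under eq_fun do rewrite big_cons; apply: measurable_maxr.
Qed.

Lemma measurable_cusum (y : Om -> nat -> R) s v e :
  (forall t, measurable_fun setT (fun w => y w t)) -> measurable_fun setT (fun w => cusum (y w) s v e).
Proof.
move=> my; rewrite /cusum.
by apply: measurable_funB; apply: measurable_funM => //; apply: measurable_sum.
Qed.

Lemma measurable_score p n (Y : Om -> 'I_p -> nat -> R) g s v e :
  (forall i t, measurable_fun setT (fun w => Y w i t)) ->
  measurable_fun setT (fun w => score n (Y w) g s v e).
Proof.
move=> mY; have mt t : measurable_fun setT (fun w => score_t n (Y w) g s v e t).
  apply: measurable_funB => //; apply: measurable_sum => i.
  apply: (@measurableT_comp _ _ _ _ _ _ (thr (a_thr R p n t))); first exact: measurable_thr.
  exact: measurable_cusum.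
exact: measurable_bigmax.
Qed.

Lemma measurable_eq_set (f g : Om -> R) : measurable_fun setT f -> measurable_fun setT g ->
  measurable [set w | f w == g w].
Proof.
move=> mf mg.
rewrite [X in measurable X](_ : _ = (fun w => f w - g w) @^-1` [set 0]); last first.
  by apply/seteqP; split => w /=; [move=> /eqP ->; rewrite subrr|move/subr0_eq => ->].
rewrite -[X in measurable X]setTI; apply: measurable_funB => //.
Qed.

(** Induction on [s], splitting on the event that the head passes the test; [Q] is left arbitrary so
    that the hypothesis applies to the tail. *)
Lemma measurable_nth_find (s : seq nat) (q : Om -> nat -> bool) (Q : nat -> bool) :
  (forall v, measurable [set w | q w v]) ->
  measurable [set w | Q (nth 0%N s (find (q w) s))].
Proof.
move=> mq; have mc (b : bool) : measurable [set w : Om | b].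
  by case: b; [rewrite [X in measurable X](_ : _ = setT)|rewrite [X in measurable X](_ : _ = set0)];
   rewrite //; apply/seteqP; split.
elim: s => [|x s IH]; first exact: (mc (Q 0%N)).
rewrite [X in measurable X](_ : _ = ([set w | q w x] `&` [set w | Q x]) `|`
  (~` [set w | q w x] `&` [set w | Q (nth 0%N s (find (q w) s))])).
  by apply: measurableU; apply: measurableI => //; exact: measurableC.
apply/seteqP; split => w /=.
  by case: (boolP (q w x)) => /= h; [left|right].
by case: (boolP (q w x)) => /= h; case => -[].
Qed.

Lemma measurable_smallest_argmax n (f : Om -> nat -> R) (Q : nat -> bool) :
  (forall v, measurable_fun setT (fun w => f w v)) ->
  measurable [set w | Q (smallest_argmax n (f w))].
Proof.
move=> mf; apply: measurable_nth_find => v; apply: measurable_eq_set => //.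
exact: measurable_bigmax.
Qed.
End measurability.

(** * Standardising the noise *)

Section noise.
Context d (Om : measurableType d) (R : realType) (P : probability Om R).

Lemma mutually_independent_scale (I : finType) (X : I -> Om -> R) (c : R) :
  mutually_independent P X -> mutually_independent P (fun i w => X i w / c).
Proof.
move=> iX J B mB; have mB' i : measurable ((fun x : R => x / c) @^-1` B i).
  by rewrite -[X in measurable X]setTI; apply: measurable_funM.
exact: iX J (fun i => (fun x : R => x / c) @^-1` B i) mB'.
Qed.

Lemma gauss_law_normal (W : {RV P >-> R}) (s : R) : 0 < s ->
  (forall A, measurable A -> distribution P W A = normal_prob 0 s A) ->
  gauss_law P (fun w => W w / s) 1.
Proof.
move=> s0 hW f mf f0.
have mfs : measurable_fun setT (fun x : R => f (x / s)).
  by apply: measurableT_comp => //; exact: measurable_funM.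
have mW : measurable_fun setT (W : Om -> measurableTypeR R).
  by move=> _ B mB; exact: measurable_funP.
pose V : {RV P >-> measurableTypeR R} := @mfun_Sub _ _ Om (measurableTypeR R) (W : Om -> measurableTypeR R) (mem_set mW).
transitivity (\int[distribution P V]_x f (x / s)%R)%E.
  by rewrite ge0_integral_distribution.
transitivity (\int[normal_prob 0 s]_x f (x / s)%R)%E.
  by apply: eq_measure_integral => A mA _; exact: hW.
rewrite (ge0_integral_normal_scale s0 mfs)//.
by apply: eq_integral => z _; rewrite mul1r mulrAC divff ?gt_eqF// mul1r.
Qed.
End noise.

(** * The model in CUSUM coordinates and the final localization *)

Section model.
Context {R : realType}.

Lemma sum_nat_ord (F : nat -> R) n : \sum_(1 <= t < n.+1) F t = \sum_(t < n) F t.+1.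
Proof. by rewrite big_add1 big_mkord. Qed.

Lemma cusum_model (m x : nat -> R) (s : R) n eta v : (0 < v < n)%N -> (0 < eta < n)%N ->
  (forall t, (1 <= t < n)%N -> t <> eta -> m t = m t.+1) ->
  cusum (fun t => (m t + x t) / s) 0 v n =
  - ((m eta.+1 - m eta) / s) * psi n eta v + \sum_(t < n) cusum_weight n v t.+1 * (x t.+1 / s).
Proof.
move=> vn en hm; rewrite cusumZ cusumD (cusum_step vn en hm) mulrDl; congr (_ + _).
  by ring.
rewrite cusumE// sum_nat_ord mulr_suml.
by apply: eq_bigr => t _; rewrite mulrA.
Qed.

Lemma signal_gap (p : nat) (th Z Z' : 'I_p -> R) (ps ps' : R) :
  signal_part th Z ps - signal_part th Z' ps' =
  (\sum_i th i ^+ 2) * (ps ^+ 2 - ps' ^+ 2) - 2 * \sum_i th i * (ps * Z i - ps' * Z' i).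
Proof.
rewrite /signal_part -sumrB mulr_suml mulr_sumr -sumrB.
by apply: eq_bigr => i _; ring.
Qed.

(** With [K = 9] the exponential is [n^-7], and [15 <= 2^5 <= n^5]. *)
Lemma pow_bound n : (2 <= n)%N ->
  15 * n%:R * expR (- (9 - 2) * ln n%:R) <= n%:R^-1 :> R.
Proof.
move=> n2; have n0 : 0 < n%:R :> R by rewrite ltr0n ltnW.
have -> : expR (- (9 - 2) * ln n%:R) = (n%:R ^+ 7)^-1 :> R.
  rewrite -(lnK (exprn_gt0 7 n0 : _ \is Num.pos)) -expRN lnXn// -mulr_natl.
  by congr expR; ring.
have n2R : 2 <= n%:R :> R by rewrite ler_nat.
rewrite ler_pdivrMr ?exprn_gt0// (_ : n%:R^-1 * n%:R ^+ 7 = n%:R * n%:R ^+ 5); last first.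
  by field; rewrite gt_eqF.
rewrite mulrC ler_wpM2l ?(ltW n0)//.
apply: (@le_trans _ _ (2 ^+ 5)); first by lra.
by rewrite lerXn2r ?nnegrE ?(ltW n0).
Qed.
End model.

(** At a maximiser the score bounds and the cross term give [F2 * D v / 2 < 4 K h + 2 slack h], and
    [psi_gap] loses another factor 2; [C] is the result with a margin [+ 1]. The conclusion is kept
    as a product, without division by [phi2]. *)
Lemma changepoint_localization (R : realType) (n p : nat) (sigma : R) (mu : 'I_p -> nat -> R)
    (eta : nat) (d : measure_display) (Omega : measurableType d) (P : probability Omega R)
    (W : 'I_p -> nat -> {RV P >-> R}) (K : R) :
  let theta := fun i => mu i eta.+1 - mu i eta in
  let k := #|[pred i : 'I_p | theta i != 0]| in
  let phi2 := \sum_(i < p) theta i ^+ 2 in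
  let h := h_fun R p n k in
  let C := 4 * (4 * K + 2 * slack K) + 1 in
  let hat := fun w => eta_hat n (fun i t => (mu i t + W i t w) / sigma) (fun t => penalty_const K * r_fun R p n t) in
  (2 <= n)%N -> (1 <= p)%N -> 0 < sigma -> 2 <= K ->
  (forall i t, (1 <= t <= n)%N ->
     forall A, measurable A -> distribution P (W i t) A = normal_prob 0 sigma A) ->
  mutually_independent P (fun it : 'I_p * 'I_n => (W it.1 (nat_of_ord it.2).+1 : Omega -> R)) ->
  (0 < eta < n)%N ->
  (forall v, (1 <= v < n)%N -> ((exists i, mu i v <> mu i v.+1) <-> v = eta)) ->
  C * h <= phi2 * (minn eta (n - eta))%:R / sigma ^+ 2 ->
  whp P (15 * n%:R * expR (- (K - 2) * ln n%:R))
    (fun w => phi2 * `|(hat w)%:R - eta%:R| <= C * sigma ^+ 2 * h).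
Proof.
move=> theta k phi2 h C hat n2 p1 s0 K2 hW iW en hmu hSNR.
have n0 : (0 < n)%N by exact: ltnW.
have hm i t : (1 <= t < n)%N -> t <> eta -> mu i t = mu i t.+1.
  move=> tn te; apply/eqP/negPn/negP => /eqP hne.
  by apply: te; apply/(hmu t tn); exists i.
have [i0 hi0] : exists i, mu i eta <> mu i eta.+1 by apply/(hmu eta en).
pose th i := theta i / sigma.
have thE i : (th i != 0) = (theta i != 0).
  by rewrite /th mulf_eq0 invr_eq0 (gt_eqF s0) orbF.
have kE : #|[pred i | th i != 0]| = k by apply: eq_card => i; rewrite !inE thE.
have k1 : (1 <= #|[pred i | th i != 0%R]|)%N.
  rewrite kE; apply/card_gt0P; exists i0; rewrite inE subr_eq0 eq_sym.
  by apply/eqP.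
pose Y (it : 'I_p * 'I_n) (w : Omega) : R := W it.1 it.2.+1 w / sigma.
have mY it : measurable_fun setT (Y it) by apply: measurable_funM.
have iY : mutually_independent P Y by exact: mutually_independent_scale iW.
have gY it : gauss_law P (Y it) 1.
  by apply: gauss_law_normal => //; apply: hW; rewrite /= ltn_ord.
have rows (c : 'I_n -> R) : \sum_t c t ^+ 2 = 1 ->
    iid_gauss P (fun i w => \sum_t c t * Y (i, t) w) by exact: iid_gauss_rows.
pose Z v i w := \sum_(t < n) cusum_weight n v t.+1 * Y (i, t) w.
have iZ v : (0 < v < n)%N -> iid_gauss P (Z v).
  by move=> vn; apply: rows; rewrite -(sum_nat_ord (fun t => cusum_weight n v t ^+ 2)) cusum_weight_sumsq.
pose ps v : R := psi n eta v.
pose D v := ps eta ^+ 2 - ps v ^+ 2.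
pose Y0 w i t := (mu i t + W i t w) / sigma.
have cE v i w : (0 < v < n)%N -> cusum (Y0 w i) 0 v n = - th i * ps v + Z v i w.
  by move=> vn; rewrite (cusum_model _ _ vn en (hm i)).
pose lam t := penalty_const K * r_fun R p n t.
pose L : R := ln n%:R.
pose F2 := \sum_i th i ^+ 2.
have F2E : F2 = phi2 / sigma ^+ 2.
  by rewrite /F2 /phi2 mulr_suml; apply: eq_bigr => i _; rewrite /th expr_div_n.
have F20 : 0 <= F2 by apply: sumr_ge0 => i _; exact: sqr_ge0.
have Lh : L <= h by rewrite /h -kE; exact: h_ge_L.
have L2 := @ln_ge_half R n n2; rewrite -/L in L2.
set rho := expR _.
have r0 : 0 <= rho by exact: expR_ge0.
have eKL : expR (- (K * L)) <= rho by rewrite -mulNr; apply: expR_rho => //; rewrite lexx.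
have gap v : (0 < v < n)%N -> Num.min (minn eta (n - eta))%:R `|v%:R - eta%:R| / 2 <= D v.
  by move=> vn; exact: psi_gap.
have Dpos v : (0 < v < n)%N -> v != eta -> 0 < D v.
  move=> vn ve; apply: lt_le_trans (gap v vn).
  rewrite divr_gt0// lt_min; apply/andP; split.
    by rewrite ltr0n leq_min subn_gt0.
  by rewrite normr_gt0 subr_eq0 eqr_nat.
have cross v : (0 < v < n)%N -> v != eta -> whp P rho (fun w =>
    2 * \sum_i th i * (ps eta * Z eta i w - ps v * Z v i w) < F2 * D v / 2 + 4 * (K * L)).
  move=> vn ve; have D0 := Dpos v vn ve.
  pose sD := Num.sqrt (D v).
  have sD0 : 0 < sD by rewrite sqrtr_gt0.
  have sD2 : sD ^+ 2 = D v by rewrite sqr_sqrtr// ltW.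
  (* The difference of the two signed contrasts has squared norm [D v] by [psi_cross]; dividing by
     its root makes it a unit contrast, so its rows are standard Gaussian. *)
  pose c (t : 'I_n) := (ps eta * cusum_weight n eta t.+1 - ps v * cusum_weight n v t.+1) / sD.
  have c1 : \sum_t c t ^+ 2 = 1.
    under eq_bigr do rewrite expr_div_n.
    rewrite -mulr_suml -(sum_nat_ord (fun t => (ps eta * cusum_weight n eta t - ps v * cusum_weight n v t) ^+ 2)).
    by rewrite psi_cross// sD2 divff// gt_eqF.
  apply: whp_sub (linear_tail (rows c c1) (fun i => th i * sD) (K * L)) => // w.
  have -> : \sum_i (th i * sD) ^+ 2 = F2 * D v.
    by rewrite /F2 mulr_suml; apply: eq_bigr => i _; rewrite exprMn sD2.
  have -> // : \sum_i th i * sD * (\sum_t c t * Y (i, t) w) =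
     \sum_i th i * (ps eta * Z eta i w - ps v * Z v i w).
  apply: eq_bigr => i _; rewrite -mulrA; congr (_ * _).
  rewrite /Z !mulr_sumr -sumrB; apply: eq_bigr => t _.
  by rewrite /c; field; rewrite gt_eqF.
have upper v : (0 < v < n)%N -> whp P (12 * rho) (fun w =>
    score n (Y0 w) lam 0 v n <= signal_part th (Z v ^~ w) (ps v) + slack K * h).
  move=> vn; apply: whp_sub (score_upper p1 n2 (iZ v vn) K2 k1 (ps v)) => // w hw.
  apply: score_le => t tc; rewrite score_tE /h -kE.
  under eq_bigr do rewrite cE//.
  exact: hw.
have lower : whp P (2 * rho) (fun w =>
    signal_part th (Z eta ^~ w) (ps eta) - slack K * h <= score n (Y0 w) lam 0 eta n).
  apply: whp_sub (score_lower p1 n2 (iZ eta en) K2 k1 (ps eta)) => // w [t tc ht].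
  apply: le_trans (score_ge (Y0 w) lam 0 eta n tc); rewrite score_tE /h -kE.
  under eq_bigr do rewrite cE//.
  exact: ht.
(* At [v = eta] the difference contrast is zero and cannot be normalised, so nothing is claimed
   there. *)
pose Q v w := v != eta ->
    2 * \sum_i th i * (ps eta * Z eta i w - ps v * Z v i w) < F2 * D v / 2 + 4 * (K * L) /\
    score n (Y0 w) lam 0 v n <= signal_part th (Z v ^~ w) (ps v) + slack K * h.
have hQ v : v \in iota 1 n.-1 -> whp P (13 * rho) (Q v).
  rewrite mem_iota add1n (prednK n0) => vn.
  have [->|ve] := eqVneq v eta.
    by apply: whp_sub (whpT P (Q := Q eta) _) => //; [lra|rewrite /Q eqxx].
  apply: whp_sub (whp_and (cross v vn ve) (upper v vn)); first by lra.
  by move=> w [h1 h2] _.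
(* The [n - 1] locations cost [13 rho] each and the lower bound at [eta] costs [2 rho]; together at
   most [15 n rho]. *)
apply: whp_sub (whp_and (whp_all hQ) lower).
  rewrite big_const_seq count_predT size_iota iter_addr_0 -mulr_natl.
  have : n.-1%:R * (13 * rho) <= n%:R * (13 * rho).
    by rewrite ler_wpM2r ?ler_nat ?leq_pred//; lra.
  have n2R : 2 <= n%:R :> R by rewrite ler_nat.
  have : 2 * rho <= n%:R * rho by rewrite ler_wpM2r.
  lra.
move=> w [h1 h2]; rewrite leNgt; apply/negP => far.
have [hatn hats] := @smallest_argmaxP R n (fun v => score n (Y0 w) lam 0 v n) eta en.
rewrite -/(hat w) in hatn hats.
set v := hat w in far hatn hats.
have h0 : 0 < h by lra.
have sl0 : 0 <= slack K by have := penalty_const_ge0 K2; rewrite /slack; lra.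
have C0 : 0 < C by rewrite /C; lra.
have s20 : 0 < sigma ^+ 2 by exact: exprn_gt0.
have ve : v != eta.
  apply: contraTneq far => ->; rewrite subrr normr0 mulr0 -leNgt.
  by rewrite !mulr_ge0// ltW.
have [g1 g2] : _ /\ _ := h1 v ltac:(by rewrite mem_iota add1n (prednK n0)) ve.
(* The signal-to-noise hypothesis treats the first argument of the minimum, and the assumption [far]
   the second. *)
have hD : C * h <= F2 * Num.min (minn eta (n - eta))%:R `|v%:R - eta%:R|.
  rewrite minr_pMr// le_min; apply/andP; split.
    by rewrite F2E mulrAC.
  by rewrite F2E mulrAC ler_pdivlMr// ltW// mulrAC.
have := ler_wpM2l F20 (gap v hatn).
have := signal_gap th (Z eta ^~ w) (Z v ^~ w) (ps eta) (ps v).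
rewrite -/F2 -/(D v) mulrA => e1 e2; cbv beta in hats.
have KL : K * L <= K * h by rewrite ler_wpM2l//; lra.
have sh0 : 0 <= slack K * h by rewrite mulr_ge0// ltW.
have CE : C * h = 4 * (4 * (K * h) + 2 * (slack K * h)) + h by rewrite /C; ring.
move: (F2 * D v) (F2 * Num.min _ _) e1 e2 hD g1 => X1 X2 e1 e2 hD g1.
lra.
Qed.

Theorem theorem1 (R : realType) :
  exists (lambda0 C0 C1 : R), 0 < lambda0 /\ 0 < C0 /\ 0 < C1 /\
  forall (n p : nat) (sigma : R) (mu : 'I_p -> nat -> R) (eta : nat)
         (d : measure_display) (Omega : measurableType d)
         (P : probability Omega R) (W : 'I_p -> nat -> {RV P >-> R}),
    (2 <= n)%N -> (1 <= p)%N -> 0 < sigma ->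
    (* noise: W_{i,t}, 1 <= t <= n, i.i.d. N(0, sigma^2) *)
    (forall i t, (1 <= t <= n)%N ->
       forall A, measurable A -> distribution P (W i t) A = normal_prob 0 sigma A) ->
    mutually_independent P (fun it : 'I_p * 'I_n => (W it.1 (nat_of_ord it.2).+1 : Omega -> R)) ->
    (* exactly one changepoint, at eta *)
    (0 < eta < n)%N ->
    (forall v, (1 <= v < n)%N -> ((exists i, mu i v <> mu i v.+1) <-> v = eta)) ->
    let theta := fun i => mu i eta.+1 - mu i eta in
    let k := #|[pred i : 'I_p | theta i != 0]| in
    let phi := Num.sqrt (\sum_(i < p) theta i ^+ 2) in
    let Delta := minn eta (n - eta) in
    let lambda := fun t => lambda0 * r_fun R p n t in
    phi ^+ 2 * Delta%:R / sigma ^+ 2 >= C0 * h_fun R p n k ->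
    ((1 - n%:R^-1)%:E <=
      P [set w : Omega |
          (`|(eta_hat n (fun i t => (mu i t + W i t w) / sigma) lambda)%:R - eta%:R|
            <= C1 * sigma ^+ 2 / phi ^+ 2 * h_fun R p n k)%R])%E.
Proof.
(* Makes [rho = n^-7], enough for the union over locations to stay below [1/n]. *)
pose K : R := 9; have K2 : 2 <= K by rewrite /K; lra.
have l0 := penalty_const_ge0 K2.
have lam0 : 0 < penalty_const K.
  have := @thr_const_ge0 R; have := @thr_excess_const_ge0 R; rewrite /penalty_const /K.
  by move: (@thr_const R) (@thr_excess_const R) => x y x0 y0; lra.
pose C := 4 * (4 * K + 2 * slack K) + 1.
have C0 : 0 < C by rewrite /C /slack /K in l0 *; lra.
exists (penalty_const K), C, C; split=> //; split=> //; split=> //.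
move=> n p sigma mu eta d Omega P W n2 p1 s0 hW iW en hmu theta k phi Delta lambda hSNR.
have [i0 hi0] : exists i, mu i eta <> mu i eta.+1 by apply/(hmu eta en).
have phiE : phi ^+ 2 = \sum_(i < p) theta i ^+ 2.
  by rewrite sqr_sqrtr// sumr_ge0// => i _; exact: sqr_ge0.
have phi0 : 0 < phi ^+ 2.
  rewrite phiE (bigD1 i0)//= ltr_wpDr//; first by rewrite sumr_ge0// => i _; exact: sqr_ge0.
  by rewrite exprn_even_gt0//= subr_eq0 eq_sym; apply/eqP.
have sub : ((1 - n%:R^-1)%:E <= (1 - 15 * n%:R * expR (- (K - 2) * ln n%:R))%:E :> \bar R)%E.
  by rewrite lee_fin lerD2l lerN2; exact: pow_bound.
apply: (le_trans sub); apply: whp_le.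
  apply: (@measurable_smallest_argmax _ Omega R n
    (fun w v => score n (fun i t => (mu i t + W i t w) / sigma) lambda 0 v n)
    (fun v => `|v%:R - eta%:R| <= C * sigma ^+ 2 / phi ^+ 2 * h_fun R p n k)) => v.
  apply: measurable_score => i t; apply: measurable_funM => //.
  exact: measurable_funD.
have := @changepoint_localization R n p sigma mu eta d Omega P W K n2 p1 s0 K2 hW iW en hmu.
rewrite -/theta -/k -phiE => /(_ hSNR).
apply: whp_sub => // w; rewrite -/lambda => hw.
by rewrite mulrAC ler_pdivlMr// mulrC.
Qed.
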